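(* Let $\boldsymbol{\alpha}=(\alpha_u)_{\emptyset\neq u\subseteq S}$ be local smoothness parameters and $\boldsymbol{\gamma}=(\gamma_u)_{u\subseteq S}$ local weight parameters on the partition $\mathcal{P}=\{J_{\boldsymbol{j},\boldsymbol{l}}:(\boldsymbol{j},\boldsymbol{l})\in\boldsymbol{D}\}$ of $\mathbb{R}^s$, satisfying the summability assumption stated in the context. Let $P=\{\boldsymbol{x}_0,\dots,\boldsymbol{x}_{N-1}\}\subset\mathbb{R}^s$ be such that for each $(\boldsymbol{j},\boldsymbol{l})\in\boldsymbol{D}$ with $|N_{\boldsymbol{j},\boldsymbol{l}}|>0$ the point set $\{\boldsymbol{x}_n:n\in N_{\boldsymbol{j},\boldsymbol{l}}\}$ is a digitally shifted digital $(t_{\boldsymbol{j},\boldsymbol{l}},m_{\boldsymbol{j},\boldsymbol{l}},s)$-net over $\mathbb{Z}_b$ in $J_{\boldsymbol{j},\boldsymbol{l}}$. Let the weights $\Lambda=\{\lambda_0,\dots,\lambda_{N-1}\}$ be given by $\lambda_n=b^{j_1+\cdots+j_s}/|N_{\boldsymbol{j},\boldsymbol{l}}|$ for $n\in N_{\boldsymbol{j},\boldsymbol{l}}$. Then, with $J=J_{\boldsymbol{j},\boldsymbol{l}}$ inside the sums, $$e(H_{\boldsymbol{\alpha},\boldsymbol{\gamma}},Q_{P,\Lambda})\le\sum_{\substack{(\boldsymbol{j},\boldsymbol{l})\in\boldsymbol{D}\\|N_{\boldsymbol{j},\boldsymbol{l}}|=0}}b^{(j_1+\cdots+j_s)/2}\gamma_\emptyset(J)+\sum_{\emptyset\neq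 u\subseteq S}\ \sum_{\substack{(\boldsymbol{j},\boldsymbol{l})\in\boldsymbol{D}\\|N_{\boldsymbol{j},\boldsymbol{l}}|>0}}\gamma_u(J)\,C_{u,J}\,b^{-\alpha_u(J)(m_{\boldsymbol{j},\boldsymbol{l}}-t_{\boldsymbol{j},\boldsymbol{l}})}\binom{m_{\boldsymbol{j},\boldsymbol{l}}-t_{\boldsymbol{j},\boldsymbol{l}}+|u|}{|u|-1},$$ where $$C_{u,J}=(b-1)^{(\alpha_u(J)-1/2)|u|}\,b^{|u|/2}\,b^{1/2-\alpha_u(J)}\,b^{(\alpha_u(J)+1/2)\sum_{i\in u}j_i}.$$
   Context: Let $b\ge2$ be a prime, $\mathbb{Z}_b$ the field with $b$ elements, $s\ge1$ an integer, $S=\{1,\dots,s\}$. $\mathbb{N}$ denotes the positive integers. For $\boldsymbol{j},\boldsymbol{l}\in\mathbb{Z}^s$ put $J_{\boldsymbol{j},\boldsymbol{l}}=\prod_{i=1}^s[b^{j_i}l_i,b^{j_i}(l_i+1))$. $\boldsymbol{D}\subset\mathbb{Z}^s\times\mathbb{Z}^s$ is a fixed set such that $\mathcal{P}=\{J_{\boldsymbol{j},\boldsymbol{l}}:(\boldsymbol{j},\boldsymbol{l})\in\boldsymbol{D}\}$ is a partition of $\mathbb{R}^s$. Parameters: local weight parameters are functions $\gamma_u:\mathcal{P}\to(0,\infty)$, $u\subseteq S$, with $\sup_{J\in\mathcal{P}}\gamma_u(J)<\infty$ for each $u$. Local smoothness parameters are functions $\alpha_u:\mathcal{P}\to(0,\infty)$,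 $\emptyset\neq u\subseteq S$, with $\sup_{J}\alpha_u(J)\le1$ and $\inf_{J}\alpha_u(J)>1/2$. Variation: for a box $I=\prod_i[x_i,y_i)$, $\Delta(f,I)$ is the alternating sum of $f$ over the vertices of $I$ (adjacent vertices have opposite signs). For $1/2<\alpha\le1$ and a box $J$, $V^{(s)}_{\alpha,J}(f)=\sup_{\mathcal{P}_J}\big(\sum_{I\in\mathcal{P}_J}\mathrm{Vol}(I)\,|\Delta(f,I)/\mathrm{Vol}(I)^{\alpha}|^2\big)^{1/2}$, the supremum being over all partitions $\mathcal{P}_J$ of $J$ into subintervals (half-open boxes). For $\emptyset\neq u\subseteq S$ and $J=J_{\boldsymbol{j},\boldsymbol{l}}$ let $J_u=\prod_{i\in u}[b^{j_i}l_i,b^{j_i}(l_i+1))$, $f_u(\boldsymbol{x}_u)=\int_{J_{S\setminus u}}f(\boldsymbol{x})\,d\boldsymbol{x}_{S\setminus u}$ (so $f_S=f$), and let $V^{(|u|)}_{\alpha,J}(f_u;u)$ be the $|u|$-dimensional quantity just defined for $f_u$ on $J_u$. For $u=\emptyset$ put $V^{(0)}_{\alpha,J}(f_\emptyset;\emptyset)=(\int_J|f|^2)^{1/2}$. Define $V_{\boldsymbol{\alpha},\boldsymbol{\gamma}}(f)=\big(\sum_{J\in\mathcal{P}}\sum_{u\subseteq S}[\gamma_u(J)^{-1}V^{(|u|)}_{\alpha_u(J),J}(f_u;u)]^2\big)^{1/2}$ and $H_{\boldsymbol{\alpha},\boldsymbol{\gamma}}=\{f:\mathbb{R}^s\to\mathbb{R}\text{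 continuous}: V_{\boldsymbol{\alpha},\boldsymbol{\gamma}}(f)<\infty\}$. Summability assumption (standing): for all $u\subseteq S$, $\sum_{(\boldsymbol{j},\boldsymbol{l})\in\boldsymbol{D}}b^{\alpha_u(J)\sum_{i\in u}j_i-\sum_{i\notin u}j_i/2}\gamma_u(J)<\infty$, where $J=J_{\boldsymbol{j},\boldsymbol{l}}$ (for $u=\emptyset$ the term with $\alpha_u$ is absent). Quadrature: $Q_{P,\Lambda}(f)=\sum_{n=0}^{N-1}\lambda_nf(\boldsymbol{x}_n)$, and $e(H_{\boldsymbol{\alpha},\boldsymbol{\gamma}},Q_{P,\Lambda})=\sup\{|Q_{P,\Lambda}(f)-\int_{\mathbb{R}^s}f(\boldsymbol{x})\,d\boldsymbol{x}|: f\in H_{\boldsymbol{\alpha},\boldsymbol{\gamma}},\ V_{\boldsymbol{\alpha},\boldsymbol{\gamma}}(f)\le1\}$. $N_{\boldsymbol{j},\boldsymbol{l}}=\{0\le n<N:\boldsymbol{x}_n\in J_{\boldsymbol{j},\boldsymbol{l}}\}$. Nets: a digitally shifted digital $(t,m,s)$-net over $\mathbb{Z}_b$ (with $0\le t\le m$) is a point set $\{\boldsymbol{y}_0,\dots,\boldsymbol{y}_{b^m-1}\}\subset[0,1)^s$ for which there are matrices $C_1,\dots,C_s$ over $\mathbb{Z}_b$ with $m$ columns and rows indexed by $1,2,\dots$ (an $m\times m$ matrix is extended by zero rows) and shifts $\sigma_i=(\sigma_{i,1},\sigma_{i,2},\dots)$ over $\mathbb{Z}_b$ such that, for $0\le n<b^m$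 with digit vector $\vec{n}\in\mathbb{Z}_b^m$, the $k$-th base $b$ digit of the $i$-th coordinate of $\boldsymbol{y}_n$ is the $k$-th entry of $C_i\vec{n}+\sigma_i$ (these being base $b$ expansions with infinitely many digits different from $b-1$), and such that for all $d_1,\dots,d_s\ge0$ with $d_1+\cdots+d_s=m-t$ the first $d_i$ rows of $C_i$, $1\le i\le s$, are altogether linearly independent. A point set in $J_{\boldsymbol{j},\boldsymbol{l}}$ is a digitally shifted digital $(t,m,s)$-net over $\mathbb{Z}_b$ in $J_{\boldsymbol{j},\boldsymbol{l}}$ if its image under $\boldsymbol{x}\mapsto(b^{-j_i}x_i-l_i)_{i=1}^s$ is a digitally shifted digital $(t,m,s)$-net over $\mathbb{Z}_b$. *)

(* Defs.v *)
From HB Require Import structures.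
From mathcomp Require Import all_boot all_order all_algebra.
From mathcomp Require Import all_classical all_reals all_analysis.

Set Implicit Arguments.
Unset Strict Implicit.
Unset Printing Implicit Defensive.

Import Order.TTheory GRing.Theory Num.Theory.
Import numFieldNormedType.Exports.

Local Open Scope classical_set_scope.
Local Open Scope ring_scope.

(* Points of R^n are row vectors 'rV[R]_n, which carry the product topology.
   The library puts the product Borel sigma-algebra on n.-tuples instead, so
   integrals over R^n range over tuples and are transported by [rV_of_tuple];
   [measurableTypeR R] is R with its Borel sigma-algebra. *)
Definition rV_of_tuple (T : Type) (n : nat) (y : n.-tuple T) : 'rV[T]_n :=
  \row_i tnth y i.

(* For n = 0 this is the unit mass on the one-point space R^0. *)
Fixpoint lebesgue_tuple (R : realType) (n : nat) :
    set (n.-tuple (measurableTypeR R)) -> \bar R :=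
  match n return set (n.-tuple (measurableTypeR R)) -> \bar R with
  | 0 => dirac ([tuple] : 0.-tuple (measurableTypeR R))
  | p.+1 => pushforward
              (product_measure1 (@lebesgue_measure R) (@lebesgue_tuple R p))
              (fun z : measurableTypeR R * p.-tuple (measurableTypeR R) =>
                 [tuple of z.1 :: z.2])
  end.

Section lebesgue_cons.
Context (R : realType) (p : nat)
  (mu : {sigma_finite_measure set (p.-tuple (measurableTypeR R)) -> \bar R}).

Let cons_tuple (z : measurableTypeR R * p.-tuple (measurableTypeR R)) :
  p.+1.-tuple (measurableTypeR R) := [tuple of z.1 :: z.2].

Let measurable_cons_tuple : measurable_fun setT cons_tuple.
Proof. exact: measurable_cons. Qed.

Definition lebesgue_cons :=
  pushforward (product_measure1 (@lebesgue_measure R) mu) cons_tuple.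

Let lebesgue_cons_semi_sigma_additive : semi_sigma_additive lebesgue_cons.
Proof.
move=> F mF tF mUF; rewrite /lebesgue_cons /pushforward preimage_bigcup.
apply: measure_semi_sigma_additive.
- by move=> n; rewrite -[X in measurable X]setTI; exact: measurable_cons_tuple.
- apply/trivIsetP => /= i j _ _ ij; rewrite -preimage_setI.
  by move/trivIsetP : tF => /(_ _ _ _ _ ij) ->//; rewrite preimage_set0.
- by rewrite -preimage_bigcup -[X in measurable X]setTI;
    exact: measurable_cons_tuple.
Qed.

Let lebesgue_cons0 : lebesgue_cons set0 = 0%E.
Proof. by rewrite /lebesgue_cons /pushforward preimage_set0 measure0. Qed.

Let lebesgue_cons_ge0 A : (0 <= lebesgue_cons A)%E.
Proof. exact: measure_ge0. Qed.

HB.instance Definition _ := isMeasure.Build _ _ _ lebesgue_cons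
  lebesgue_cons0 lebesgue_cons_ge0 lebesgue_cons_semi_sigma_additive.

Let lebesgue_cons_sigma_finite : sigma_finite setT lebesgue_cons.
Proof.
have /sigma_finiteP[F [FT ndF mF]] := sigma_finiteT (@lebesgue_measure R).
have /sigma_finiteP[G [GT ndG mG]] := sigma_finiteT mu.
pose uncons (y : p.+1.-tuple (measurableTypeR R)) := (thead y, [tuple of behead y]).
have consK : cancel cons_tuple uncons.
  by move=> [a y]; congr pair; apply/val_inj.
have unconsK : cancel uncons cons_tuple.
  by move=> y; rewrite [RHS]tuple_eta; apply/val_inj.
have muncons : measurable_fun setT uncons.
  apply/measurable_fun_pairP; split => /=.
    exact: (measurable_tnth ord0).
  exact: measurable_behead.
exists (fun i => uncons @^-1` (F i `*` G i)).
  apply/esym; rewrite -subTset => y _.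
  have [i _ Fi] : (\bigcup_i F i) (uncons y).1 by rewrite -FT.
  have [k _ Gk] : (\bigcup_i G i) (uncons y).2 by rewrite -GT.
  exists (maxn i k) => //; split.
  - by move: Fi; exact/subsetPset/ndF/leq_maxl.
  - by move: Gk; exact/subsetPset/ndG/leq_maxr.
move=> i; have [mFi Fioo] := mF i; have [mGi Gioo] := mG i; split.
  by rewrite -[X in measurable X]setTI; apply: muncons => //; exact: measurableX.
rewrite /lebesgue_cons /pushforward -comp_preimage.
rewrite (_ : uncons \o cons_tuple = id); last by apply/funext => z; exact: consK.
by rewrite preimage_id product_measure1E// lte_mul_pinfty// ge0_fin_numE.
Qed.

HB.instance Definition _ := @Measure_isSigmaFinite.Build _ _ _ lebesgue_cons
  lebesgue_cons_sigma_finite.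

End lebesgue_cons.

Lemma lebesgue_tuple_measure (R : realType) (n : nat) :
  exists mu : {sigma_finite_measure set (n.-tuple (measurableTypeR R)) -> \bar R},
    @lebesgue_tuple R n = mu :> (set (n.-tuple (measurableTypeR R)) -> \bar R).
Proof.
elim: n => [|p [mu muE]].
  by exists [the {sigma_finite_measure set _ -> \bar R}
    of dirac ([tuple] : 0.-tuple (measurableTypeR R))].
by exists [the {sigma_finite_measure set _ -> \bar R} of lebesgue_cons mu];
  rewrite /= muE.
Qed.

Section lebesgue_tuple.
Context (R : realType) (n : nat).
Local Notation leb := (@lebesgue_tuple R n).

Let leb0 : leb set0 = 0%E.
Proof. by have [mu ->] := lebesgue_tuple_measure R n; rewrite measure0. Qed.

Let leb_ge0 A : (0 <= leb A)%E.
Proof. by have [mu ->] := lebesgue_tuple_measure R n; exact: measure_ge0. Qed.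

Let leb_semi_sigma_additive : semi_sigma_additive leb.
Proof.
have [mu ->] := lebesgue_tuple_measure R n.
exact: measure_semi_sigma_additive.
Qed.

HB.instance Definition _ :=
  isMeasure.Build _ _ _ leb leb0 leb_ge0 leb_semi_sigma_additive.

Let leb_sigma_finite : sigma_finite setT leb.
Proof.
have [mu ->] := lebesgue_tuple_measure R n; exact: sigma_finiteT.
Qed.

HB.instance Definition _ :=
  @Measure_isSigmaFinite.Build _ _ _ leb leb_sigma_finite.

End lebesgue_tuple.

Definition integral_rV (R : realType) (n : nat) (A : set 'rV[R]_n)
    (g : 'rV[R]_n -> R) : \bar R :=
  (\int[@lebesgue_tuple R n]_(y in [set y | A (rV_of_tuple y)])
     (g (rV_of_tuple y))%:E)%E.

(* A pair I = (x, y) stands for the half-open box prod_i [x_i, y_i). *)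
Definition box (R : realType) (n : nat) (I : 'rV[R]_n * 'rV[R]_n) :
    set 'rV[R]_n :=
  [set z | forall i, I.1 0 i <= z 0 i < I.2 0 i].

Definition box_volume (R : realType) (n : nat) (I : 'rV[R]_n * 'rV[R]_n) : R :=
  \prod_i (I.2 0 i - I.1 0 i).

(* The vertex attached to v has the lower endpoint x_i for i in v and the upper
   endpoint y_i otherwise. *)
Definition box_difference (R : realType) (n : nat) (g : 'rV[R]_n -> R)
    (I : 'rV[R]_n * 'rV[R]_n) : R :=
  \sum_(v : {set 'I_n})
    (-1) ^+ #|v| * g (\row_i if i \in v then I.1 0 i else I.2 0 i).

(* [partition] requires the boxes to be nonempty, hence of positive volume. *)
Definition variation_alpha (R : realType) (n : nat) (alpha : R)
    (J : set 'rV[R]_n) (g : 'rV[R]_n -> R) : \bar R :=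
  ereal_sup
    [set (poweR (\esum_(I in Q)
            (box_volume I *
             (`|box_difference g I| / box_volume I `^ alpha) ^+ 2)%:E)
          2^-1)
    | Q in [set Q : set ('rV[R]_n * 'rV[R]_n) | partition Q (@box R n) J]].

(* J_{j,l} is the box attached to the pair jl = (j, l). *)
Definition elem_box (R : realType) (b n : nat) (jl : 'rV[int]_n * 'rV[int]_n) :
    set 'rV[R]_n :=
  box (\row_i (b%:R ^ jl.1 0 i * (jl.2 0 i)%:~R),
       \row_i (b%:R ^ jl.1 0 i * (jl.2 0 i + 1)%:~R)).

Definition elem_boxes (R : realType) (b s : nat)
    (D : set ('rV[int]_s * 'rV[int]_s)) : set (set 'rV[R]_s) :=
  @elem_box R b s @` D.

(* Coordinates in u are renumbered by 'I_#|u|, in increasing order. *)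
Definition restrict_rV (T : Type) (s : nat) (u : {set 'I_s}) (x : 'rV[T]_s) :
    'rV[T]_#|u| :=
  \row_k x 0 (enum_val k).

Definition restrict_pair (s : nat) (u : {set 'I_s})
    (jl : 'rV[int]_s * 'rV[int]_s) : 'rV[int]_#|u| * 'rV[int]_#|u| :=
  (restrict_rV u jl.1, restrict_rV u jl.2).

Definition extend_rV (R : realType) (s : nat) (u : {set 'I_s})
    (x : 'rV[R]_#|u|) : 'rV[R]_s :=
  \sum_k x 0 k *: delta_mx 0 (enum_val k).

(* The point with coordinates x_u in u and y outside u is
   extend_rV x_u + extend_rV y. *)
Definition marginal (R : realType) (b s : nat) (f : 'rV[R]_s -> R)
    (u : {set 'I_s}) (jl : 'rV[int]_s * 'rV[int]_s) (xu : 'rV[R]_#|u|) : R :=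
  fine (integral_rV (elem_box b (restrict_pair (~: u)%SET jl))
          (fun y => f (extend_rV xu + extend_rV y))).

(* For u empty the parameter alpha is not used. *)
Definition local_variation (R : realType) (b s : nat) (f : 'rV[R]_s -> R)
    (u : {set 'I_s}) (alpha : R) (jl : 'rV[int]_s * 'rV[int]_s) : \bar R :=
  if u == finset.set0
  then poweR (integral_rV (elem_box b jl) (fun x => `|f x| ^+ 2)) 2^-1
  else variation_alpha alpha (elem_box b (restrict_pair u jl))
         (marginal b f jl).

(* Parameters are functions on sets; only their values on the boxes of the
   partition matter. *)
Definition weighted_variation (R : realType) (b s : nat)
    (D : set ('rV[int]_s * 'rV[int]_s))
    (alpha gamma : {set 'I_s} -> set 'rV[R]_s -> R) (f : 'rV[R]_s -> R) :
    \bar R :=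
  poweR (\esum_(jl in D) \sum_(u : {set 'I_s})
     ((gamma u (elem_box b jl))^-1%:E *
      local_variation b f u (alpha u (elem_box b jl)) jl) ^+ 2)%E 2^-1.

Definition function_space (R : realType) (b s : nat)
    (D : set ('rV[int]_s * 'rV[int]_s))
    (alpha gamma : {set 'I_s} -> set 'rV[R]_s -> R) : set ('rV[R]_s -> R) :=
  [set f | continuous f /\ (weighted_variation b D alpha gamma f < +oo)%E].

Definition local_weights (R : realType) (b s : nat)
    (D : set ('rV[int]_s * 'rV[int]_s))
    (gamma : {set 'I_s} -> set 'rV[R]_s -> R) : Prop :=
  forall u : {set 'I_s},
    (forall J, elem_boxes b D J -> 0 < gamma u J) /\
    (ereal_sup [set (gamma u J)%:E | J in elem_boxes b D] < +oo)%E.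

Definition local_smoothness (R : realType) (b s : nat)
    (D : set ('rV[int]_s * 'rV[int]_s))
    (alpha : {set 'I_s} -> set 'rV[R]_s -> R) : Prop :=
  forall u : {set 'I_s}, u != finset.set0 ->
    [/\ forall J, elem_boxes b D J -> 0 < alpha u J,
        (ereal_sup [set (alpha u J)%:E | J in elem_boxes b D] <= 1)%E &
        ((2^-1)%:E < ereal_inf [set (alpha u J)%:E | J in elem_boxes b D])%E].

(* For u empty the sum over i in u vanishes, so alpha u plays no role. *)
Definition summability (R : realType) (b s : nat)
    (D : set ('rV[int]_s * 'rV[int]_s))
    (alpha gamma : {set 'I_s} -> set 'rV[R]_s -> R) : Prop :=
  forall u : {set 'I_s},
    (\esum_(jl in D)
       (b%:R `^ (alpha u (elem_box b jl) * (\sum_(i in u) jl.1 0 i)%:~R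
                 - (\sum_(i | i \notin u) jl.1 0 i)%:~R / 2)
        * gamma u (elem_box b jl))%:E < +oo)%E.

Definition quadrature (R : realType) (s N : nat) (x : 'I_N -> 'rV[R]_s)
    (lambda : 'I_N -> R) (f : 'rV[R]_s -> R) : R :=
  \sum_(n < N) lambda n * f (x n).

(* Where the integral of f over R^s is infinite or undefined, [integral_rV] is
   an infinite value and so is the corresponding error. *)
Definition worst_case_error (R : realType) (b s N : nat)
    (D : set ('rV[int]_s * 'rV[int]_s))
    (alpha gamma : {set 'I_s} -> set 'rV[R]_s -> R)
    (x : 'I_N -> 'rV[R]_s) (lambda : 'I_N -> R) : \bar R :=
  ereal_sup
    [set `| (quadrature x lambda f)%:E - integral_rV setT f |%E
    | f in [set f | function_space b D alpha gamma f /\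
                    (weighted_variation b D alpha gamma f <= 1)%E]].

Definition indices_in (R : realType) (b s N : nat) (x : 'I_N -> 'rV[R]_s)
    (jl : 'rV[int]_s * 'rV[int]_s) : {set 'I_N} :=
  [set n | x n \in elem_box b jl]%SET.

(* Digits are numbered from 0: d k is the coefficient of b^-(k+1). *)
Definition base_expansion (R : realType) (b : nat) (d : nat -> nat) (y : R) :
    Prop :=
  [/\ forall k, (d k < b)%N,
      forall K, exists2 k, (K <= k)%N & d k != b.-1 &
      series (fun k => (d k)%:R / b%:R ^+ k.+1) @ \oo --> y].

(* The cast to 'F_b reduces the quotient modulo b. *)
Definition digit_vector (b m n : nat) : 'cV['F_b]_m :=
  \col_r (n %/ b ^ r)%:R.

(* C i k and sigma i k are row k+1 of the matrix C_i and entry k+1 of the shift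
   sigma_i.  A digit in 'F_b is read as its representative in {0, ..., b-1}.
   Point sets are families, so that points may be repeated. *)
Definition digital_net (R : realType) (b t m s : nat)
    (y : 'I_(b ^ m) -> 'rV[R]_s) : Prop :=
  [/\ (t <= m)%N,
      forall n i, 0 <= y n 0 i < 1 &
      exists (C : 'I_s -> nat -> 'rV['F_b]_m) (sigma : 'I_s -> nat -> 'F_b),
        (forall (n : 'I_(b ^ m)) (i : 'I_s),
           base_expansion b
             (fun k => nat_of_ord
                ((C i k *m digit_vector b m n) 0 0 + sigma i k : 'F_b))
             (y n 0 i)) /\
        (forall d : 'I_s -> nat, (\sum_i d i = m - t)%N ->
           free [seq C i k | i <- enum 'I_s, k <- iota 0 (d i)])].

Definition to_unit_cube (R : realType) (b s : nat)
    (jl : 'rV[int]_s * 'rV[int]_s) (x : 'rV[R]_s) : 'rV[R]_s :=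
  \row_i (b%:R ^ (- jl.1 0 i) * x 0 i - (jl.2 0 i)%:~R).

(* The points x_n, n in A, form a net in J_{j,l} after being put in bijection
   with {0, ..., b^m - 1}. *)
Definition digital_net_in (R : realType) (b t m s N : nat)
    (jl : 'rV[int]_s * 'rV[int]_s) (x : 'I_N -> 'rV[R]_s) (A : {set 'I_N}) :
    Prop :=
  exists h : 'I_(b ^ m) -> 'I_N,
    [/\ injective h, h @: [set: 'I_(b ^ m)]%SET = A &
        @digital_net R b t m s (fun k => to_unit_cube b jl (x (h k)))].

Definition net_constant (R : realType) (b s : nat) (alpha : R)
    (u : {set 'I_s}) (jl : 'rV[int]_s * 'rV[int]_s) : R :=
  (b%:R - 1) `^ ((alpha - 2^-1) * #|u|%:R) *
  b%:R `^ (#|u|%:R / 2) *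
  b%:R `^ (2^-1 - alpha) *
  b%:R `^ ((alpha + 2^-1) * (\sum_(i in u) jl.1 0 i)%:~R).

(* Main.v *)
(* On a box J the quadrature error only involves averages of f over grids, up to
   an error that vanishes with the mesh.  Expanding f over J into its
   mixed increments along the sets u of coordinates, the part attached to u is
   the average over the net of a mixed difference of the marginal f_u.  Writing
   each increment of this difference as a telescoping sum over levels of digits,
   one stops as soon as the levels add up to m - t: a net averages exactly all
   functions constant on the elementary boxes of order m - t, so the terms that
   are left are C(m - t + |u| - 1, |u| - 1) at most.  In each of them the mixed
   difference is taken over a box contained in an elementary box; boxes lying in
   distinct elementary boxes are disjoint, so they are part of a partition, and
   Cauchy-Schwarz bounds the term by the variation of f_u.  A step from one level
   d - 1 to the next changes a single digit, so it has length (b - 1) b^-d at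
   most; this is where the powers of b - 1 come from.  Only averages over
   grids are exchanged, so that neither Walsh series nor Fubini's theorem is
   needed. *)

Require Import Defs.
From mathcomp Require Import all_boot all_order all_algebra.
From mathcomp Require Import all_classical all_reals all_analysis.
From mathcomp Require Import measurable_realfun.
From mathcomp Require Import zify ring.

Set Implicit Arguments.
Unset Strict Implicit.
Unset Printing Implicit Defensive.

Import Order.TTheory GRing.Theory Num.Theory.
Import numFieldNormedType.Exports.

Local Open Scope classical_set_scope.
Local Open Scope ring_scope.

(** * Averages over finite types *)

(** A mixed difference between levels still depends on digits beyond the lower ones, so a net does
    not average it exactly. Therefore the digits [z] that fill up the levels are fixed for all
    points of the net at once, and the absolute difference is replaced by its maximum over the
    arrays with the same leading [lo] digits. This majorant is a function of the elementary box,
    hence averaged exactly, and its maximisers provide one box per elementary box. The exponents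
    arise as follows. If [i] coordinates make a single step, the lower levels add up to k - i with k
    = m - t. Cauchy-Schwarz over b^(k-i) elementary boxes gives b^(-(k-i)/2), and the relative
    volume, at most (b-1)^i b^(-k), enters with exponent alpha - 1/2. The product is b^(-alpha k)
    times the [i]-th power of b^(1/2) (b-1)^(alpha-1/2), where i <= |u| - 1. The theorem has this
    power with |u| in place of [i], and b^(1/2-alpha) gives back part of the surplus; its binomial
    coefficient is likewise an upper estimate. *)

Section average.
Context (R : realFieldType).
Implicit Types X Y : finType.

Definition avg X (h : X -> R) : R := (\sum_x h x) / #|X|%:R.

Lemma eq_avg X (f g : X -> R) : f =1 g -> avg f = avg g.
Proof. by move=> fg; rewrite /avg (eq_bigr _ (fun x _ => fg x)). Qed.

Lemma avg_cst X (x0 : X) (c : R) : avg (fun _ : X => c) = c.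
Proof.
have X0 : (#|X|%:R : R) != 0 by rewrite pnatr_eq0; apply/eqP => /card0_eq/(_ x0).
by rewrite /avg (eq_bigl (mem X))// sumr_const -[c *+ _]mulr_natr mulfK.
Qed.

Lemma avgB X (f g : X -> R) : avg (fun x => f x - g x) = avg f - avg g.
Proof. by rewrite /avg sumrB mulrBl. Qed.

Lemma avgZ X (c : R) (f : X -> R) : avg (fun x => c * f x) = c * avg f.
Proof. by rewrite /avg -mulr_sumr mulrA. Qed.

Lemma avg_sum X (I : finType) (f : I -> X -> R) :
  avg (fun x => \sum_i f i x) = \sum_i avg (f i).
Proof. by rewrite /avg exchange_big /= -mulr_suml. Qed.

Lemma avg_exchange X Y (f : X -> Y -> R) :
  avg (fun x => avg (f x)) = avg (fun y => avg (f^~ y)).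
Proof. by rewrite /avg -!mulr_suml exchange_big mulrAC. Qed.

Lemma ler_avg X (f g : X -> R) : (forall x, f x <= g x) -> avg f <= avg g.
Proof.
by move=> fg; rewrite /avg ler_wpM2r ?invr_ge0 ?ler0n// ler_sum.
Qed.

Lemma ler_norm_avg X (f : X -> R) : `|avg f| <= avg (fun x => `|f x|).
Proof.
rewrite /avg normrM [`|_^-1|]ger0_norm ?invr_ge0 ?ler0n//.
by rewrite ler_wpM2r ?invr_ge0 ?ler0n// ler_norm_sum.
Qed.

Lemma avg_pair X Y (f : X * Y -> R) :
  avg f = avg (fun x => avg (fun y => f (x, y))).
Proof.
rewrite /avg -mulr_suml -mulrA card_prod natrM invfM [_^-1 * _^-1]mulrC.
by rewrite pair_big; congr (_ * _); apply: eq_bigr => -[].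
Qed.

Lemma avg_reindex X (s : X -> X) (f : X -> R) :
  injective s -> avg (fun x => f (s x)) = avg f.
Proof.
by move=> si; rewrite /avg; congr (_ / _); rewrite [RHS](reindex_inj si).
Qed.

(** An injection of the finite type [X * Y] into itself is onto, so both sides are averages over
    [X * Y] of the same function. Averages over types of different sizes are thus compared by
    exhibiting an involution, with no fibre to count. *)
Lemma avg_transport X Y (x0 : X) (y0 : Y) (s : X * Y -> X * Y) (f : X -> R)
    (g : Y -> R) :
  injective s -> (forall p, f (s p).1 = g p.2) -> avg f = avg g.
Proof.
move=> si fg; transitivity (avg (fun p : X * Y => f p.1)).
  by rewrite avg_pair; apply: eq_avg => x /=; rewrite (avg_cst y0).
rewrite -(avg_reindex _ si) (eq_avg fg) avg_pair.
by rewrite /= (avg_cst x0).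
Qed.

(** The variance is nonnegative. For empty [X] both averages are 0. *)
Lemma sqr_avg_le X (f : X -> R) : avg f ^+ 2 <= avg (fun x => f x ^+ 2).
Proof.
have [x0 _|X0] := pickP X; last first.
  rewrite /avg !big_pred0 ?mul0r ?expr2 ?mulr0// => x; exact: X0.
set c := avg f; rewrite -subr_ge0.
have -> : avg (fun x => f x ^+ 2) - c ^+ 2 = avg (fun x => (f x - c) ^+ 2).
  transitivity (avg (fun x => f x ^+ 2 - (2 * c * f x - c ^+ 2))).
    by rewrite !avgB avgZ (avg_cst x0) -/c; ring.
  by apply: eq_avg => x; ring.
apply: divr_ge0 => //; apply: sumr_ge0 => x _; exact: sqr_ge0.
Qed.

End average.

Section mix.
Context (R : realFieldType) (T A : finType).
Implicit Types (W : {set T}) (a z : {ffun T -> A}).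

(** Resampling outside [W]. That a function [h] depends only on the entries in [W] is written below
    as [h (mix W a z) = h a] for all [a] and [z]. *)
Definition mix W a z : {ffun T -> A} := [ffun p => if p \in W then a p else z p].

Lemma avg_mix W (z0 : {ffun T -> A}) (h : {ffun T -> A} -> R) :
  avg (fun a => avg (fun z => h (mix W a z))) = avg h.
Proof.
pose sw (p : {ffun T -> A} * {ffun T -> A}) := (mix W p.1 p.2, mix W p.2 p.1).
have swK : involutive sw.
  move=> [a z]; rewrite /sw /=; congr pair; apply/ffunP => p;
  by rewrite /mix !ffunE; case: (p \in W).
transitivity (avg (fun p => h (sw p).1)); first by rewrite avg_pair.
rewrite (avg_reindex (fun p => h p.1) (inv_inj swK)) avg_pair.
by apply: eq_avg => a /=; rewrite (avg_cst z0).
Qed.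

(** The involution exchanges the entries of [z] along the image of [i] with an independent array on
    [T']. *)
Lemma avg_restrict (T' : finType) (i : T' -> T) (z0 : {ffun T -> A})
    (h : {ffun T' -> A} -> R) :
  injective i -> avg (fun z => h [ffun k => z (i k)]) = avg h.
Proof.
move=> ii.
pose inv p := [pick k | i k == p].
have invE k : inv (i k) = Some k.
  by rewrite /inv; case: pickP => [l /eqP/ii -> //|/(_ k)]; rewrite eqxx.
pose sw (p : {ffun T -> A} * {ffun T' -> A}) :=
  ([ffun q => if inv q is Some k then p.2 k else p.1 q],
   [ffun k => p.1 (i k)]).
have swK : involutive sw.
  move=> [z w]; rewrite /sw /=; congr pair; apply/ffunP => p; last first.
    by rewrite !ffunE invE.
  rewrite !ffunE; case E : (inv p) => [k|//]; rewrite ffunE.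
  by move: E; rewrite /inv; case: pickP => // l /eqP <- [->].
apply: (@avg_transport _ _ _ z0 [ffun k => z0 (i k)] sw).
  exact: inv_inj.
move=> [z w] /=; congr h; apply/ffunP => k; by rewrite !ffunE invE.
Qed.

End mix.

Lemma free_row_free (F : fieldType) (m : nat) (T : finType) (W : {set T})
    (C : T -> 'rV[F]_m) :
  free [seq C p | p <- enum W] ->
  row_free (\matrix_(k < #|W|) C (enum_val k)).
Proof.
move=> fC; apply: inj_row_free => v vC.
move/freeP : fC => fC.
apply/rowP => k; rewrite [RHS]mxE; apply: fC => {k}.
rewrite -[RHS]vC mulmx_sum_row; apply: eq_bigr => k _; congr (_ *: _).
by rewrite rowK (nth_map (enum_default k)) -?cardE.
Qed.

Section affine_digits.
Context (R : realFieldType) (F : finFieldType) (m : nat) (T : finType).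
Context (C : T -> 'rV[F]_m) (sigma : T -> F).

Definition affine_digits (v : 'cV[F]_m) : {ffun T -> F} :=
  [ffun p => (C p *m v) 0 0 + sigma p].

(* A right inverse of the matrix of the rows in W yields an involution of the
   pairs (v, a) after which the digits in W of the first component are those
   of a. *)
Lemma avg_affine_digits (W : {set T}) (h : {ffun T -> F} -> R) :
  free [seq C p | p <- enum W] ->
  (forall a z, h (mix W a z) = h a) ->
  avg (fun v => h (affine_digits v)) = avg h.
Proof.
move=> /free_row_free; set M := (\matrix__ _) => Mfree hW.
pose dif (a c : {ffun T -> F}) : 'cV_#|W| := \col_k (a (enum_val k) - c (enum_val k)).
pose sw (p : 'cV[F]_m * {ffun T -> F}) :=
  (p.1 + pinvmx M *m dif p.2 (affine_digits p.1), mix W (affine_digits p.1) p.2).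
have swW p q : q \in W -> affine_digits (sw p).1 q = p.2 q.
  case: p => v a Wq; rewrite /sw /= ffunE mulmxDr.
  have E d : C q *m (pinvmx M *m d) = row (enum_rank_in Wq q) d.
    have -> : C q = row (enum_rank_in Wq q) M by rewrite rowK enum_rankK_in.
    by rewrite -row_mul mulmxA mulmxVp// mul1mx.
  by rewrite E mxE 2![X in _ + X + _]mxE enum_rankK_in// ffunE; ring.
have swK : involutive sw.
  move=> [v a]; have E := swW (v, a); rewrite {1}/sw /= in E *.
  congr pair; last first.
    apply/ffunP => q; rewrite ffunE; case: ifPn => Wq; first exact: E.
    by rewrite ffunE (negbTE Wq).
  rewrite /sw /= -addrA -mulmxDr; set w := v + _ in E *.
  have -> : dif a (affine_digits v) +
      dif (mix W (affine_digits v) a) (affine_digits w) = 0.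
    by apply/colP => k; rewrite !mxE E ?enum_valP// [X in _ + (X - _)]ffunE ifT ?enum_valP//; ring.
  by rewrite mulmx0 addr0.
apply: (@avg_transport _ _ _ 0 [ffun=> 0] sw); first exact: inv_inj.
move=> p; rewrite -(hW _ p.2) -[in RHS](hW p.2 p.2); congr h.
by apply/ffunP => q; rewrite ![LHS]ffunE [RHS]ffunE; case: ifP => // /swW ->.
Qed.

End affine_digits.

(** * Mixed differences and telescoping *)

Section mixed_difference.
Context (R : realFieldType).

Lemma sum_set_pair n (i : 'I_n) (H : {set 'I_n} -> R) :
  \sum_v H v = \sum_(v : {set 'I_n} | i \notin v) (H v + H (i |: v)%SET).
Proof.
rewrite (bigID (fun v : {set 'I_n} => i \notin v)) /= big_split /=; congr (_ + _).
rewrite (reindex_onto (fun v => i |: v)%SET (fun v => v :\ i)%SET) /=; last first.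
  by move=> v; rewrite negbK => iv; rewrite finset.setD1K.
apply: eq_bigl => v; rewrite negbK finset.setU11 /=.
apply/eqP/idP => [<-|iv]; first by rewrite !inE eqxx.
by rewrite finset.setU1K.
Qed.

Lemma sum_sign_subset n (A : {set 'I_n}) :
  \sum_(v : {set 'I_n} | v \subset A) (-1) ^+ #|v| = (A == finset.set0)%:R :> R.
Proof.
have [->|/set0Pn[i iA]] := eqVneq A finset.set0.
  rewrite (eq_bigl (pred1 finset.set0)) ?big_pred1_eq ?cards0 ?expr0// => v.
  by rewrite finset.subset0.
rewrite big_mkcond /= (sum_set_pair i) big1// => v iv.
rewrite finset.subUset finset.sub1set iA /= cardsU1 iv exprS mulN1r.
by case: ifP; rewrite ?addr0 ?subrr.
Qed.

(** With w = u \ v the double sum runs over the disjoint pairs (v, w). For fixed w the signs over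
    the subsets v of its complement cancel unless w is the full set. This is the expansion into
    mixed increments. *)
Lemma sum_alternating_subset n (e : {set 'I_n} -> R) :
  \sum_(u : {set 'I_n}) \sum_(v : {set 'I_n} | v \subset u) (-1) ^+ #|v| * e (u :\: v)%SET
  = e [set: 'I_n]%SET.
Proof.
pose C (v w : {set 'I_n}) := v \subset ~: w.
transitivity (\sum_v \sum_(w | C v w) (-1) ^+ #|v| * e w).
  rewrite (exchange_big_dep xpredT)//=; apply: eq_bigr => v _.
  rewrite (reindex_onto (fun w => v :|: w)%SET (fun u => u :\: v)%SET) /=; last first.
    by move=> u vu; apply/finset.setP => x; rewrite !inE;
      case: (boolP (x \in v)) => //= /(fintype.subsetP vu) ->.
  rewrite (eq_bigl (C v)); last first.
    move=> w; rewrite finset.subsetUl /= /C; apply/eqP/fintype.subsetP => [<- x xv|vw].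
      by rewrite !inE xv.
    apply/finset.setP => x; rewrite !inE; case: (boolP (x \in v)) => //= /vw.
    by rewrite inE => /negbTE ->.
  apply: eq_bigr => w vw; congr (_ * e _); apply/finset.setP => x; rewrite !inE.
  case: (boolP (x \in v)) => //= /(fintype.subsetP vw).
  by rewrite inE => /negbTE ->.
rewrite (exchange_big_dep xpredT)//= (bigD1 [set: 'I_n]%SET)//= [X in _ + X]big1 => [|w wT].
  by rewrite -mulr_suml sum_sign_subset finset.setCT eqxx mul1r addr0.
rewrite -mulr_suml sum_sign_subset; case: eqP => [w0|_]; last by rewrite mul0r.
by move: wT; rewrite -(finset.setCK w) w0 finset.setC0 eqxx.
Qed.

(** The end points have an arbitrary type because the same algebra serves for digit levels, for
    integer grid indices and for the real coordinates in [box_difference]. *)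
Definition mixed_diff (X : Type) n (Phi : ('I_n -> X) -> R) (lo hi : 'I_n -> X) : R :=
  \sum_(v : {set 'I_n}) (-1) ^+ #|v| * Phi (fun i => if i \in v then lo i else hi i).

Definition upd (X : Type) n (L : 'I_n -> X) (i : 'I_n) (x : X) : 'I_n -> X :=
  fun j => if j == i then x else L j.

Lemma upd_same (X : Type) n (L : 'I_n -> X) i : upd L i (L i) = L.
Proof. by apply/funext => j; rewrite /upd; case: eqP => [->|]. Qed.

Lemma upd_upd (X : Type) n (L : 'I_n -> X) i x y : upd (upd L i x) i y = upd L i y.
Proof. by apply/funext => j; rewrite /upd; case: eqP. Qed.

Lemma mixed_diff_pair (X : Type) n (Phi : ('I_n -> X) -> R) lo hi i :
  mixed_diff Phi lo hi = \sum_(v : {set 'I_n} | i \notin v) (-1) ^+ #|v| *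
    (Phi (upd (fun j => if j \in v then lo j else hi j) i (hi i)) -
     Phi (upd (fun j => if j \in v then lo j else hi j) i (lo i))).
Proof.
rewrite /mixed_diff (sum_set_pair i); apply: eq_bigr => v iv.
rewrite cardsU1 iv exprS mulN1r mulNr mulrBr; congr (_ * Phi _ - _ * Phi _);
  apply/funext => j; rewrite /upd; case: eqP => [->|/eqP ij].
- by rewrite (negbTE iv).
- by [].
- by rewrite finset.setU11.
- by rewrite !inE (negbTE ij).
Qed.

Lemma mixed_diff_split (X : Type) n (Phi : ('I_n -> X) -> R) lo hi i c :
  mixed_diff Phi lo hi =
  mixed_diff Phi (upd lo i c) hi + mixed_diff Phi lo (upd hi i c).
Proof.
rewrite !(mixed_diff_pair _ _ _ i) -big_split; apply: eq_bigr => v iv /=.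
have -> : upd lo i c i = c by rewrite /upd eqxx.
have -> : upd hi i c i = c by rewrite /upd eqxx.
have E x : upd (fun j => if j \in v then upd lo i c j else hi j) i x =
  upd (fun j => if j \in v then lo j else hi j) i x.
  by apply/funext => j; rewrite /upd; case: eqP.
have E' x : upd (fun j => if j \in v then lo j else upd hi i c j) i x =
  upd (fun j => if j \in v then lo j else hi j) i x.
  by apply/funext => j; rewrite /upd; case: eqP.
rewrite !E !E'; ring.
Qed.

Lemma mixed_diff_degenerate (X : Type) n (Phi : ('I_n -> X) -> R) lo hi i :
  lo i = hi i -> mixed_diff Phi lo hi = 0.
Proof.
by move=> e; rewrite (mixed_diff_pair _ _ _ i) big1// => v _; rewrite e subrr mulr0.
Qed.

Lemma sign_card_prod n (v : {set 'I_n}) :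
  (-1) ^+ #|v| = \prod_i (if i \in v then -1 else 1) :> R.
Proof. by rewrite -big_mkcond /= prodr_const. Qed.

(* Exchanging the end points in the coordinates of S multiplies the difference
   by (-1)^|S|. *)
Lemma normr_mixed_diff_swap (X : Type) n (Phi : ('I_n -> X) -> R) lo hi (S : {set 'I_n}) :
  `|mixed_diff Phi (fun i => if i \in S then hi i else lo i)
                   (fun i => if i \in S then lo i else hi i)|
  = `|mixed_diff Phi lo hi|.
Proof.
suff -> : mixed_diff Phi (fun i => if i \in S then hi i else lo i)
                   (fun i => if i \in S then lo i else hi i)
  = (-1) ^+ #|S| * mixed_diff Phi lo hi by rewrite normrM normrX normrN1 expr1n mul1r.
pose sd (v : {set 'I_n}) := [set i | (i \in v) (+) (i \in S)]%SET.
have sdK : involutive sd.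
  by move=> v; apply/finset.setP => i; rewrite !inE addbK.
rewrite /mixed_diff (reindex_inj (inv_inj sdK)) /= mulr_sumr.
apply: eq_bigr => v _; rewrite mulrA; congr (_ * Phi _).
  rewrite !sign_card_prod -big_split /=; apply: eq_bigr => i _.
  by rewrite inE; case: (i \in v); case: (i \in S) => /=; ring.
by apply/funext => i; rewrite inE; case: (i \in v); case: (i \in S).
Qed.

End mixed_difference.

Section telescoping.
Context (R : realFieldType) (n : nat) (Phi : ('I_n -> nat) -> R) (k K : nat) (B : R).
Hypothesis n_gt0 : (0 < n)%N.
Hypothesis B_ge0 : 0 <= B.
Hypothesis exact : forall L L', (\sum_i L i <= k)%N -> (\sum_i L' i <= k)%N -> Phi L = Phi L'.
(** These are the pieces at which the telescoping stops: the coordinates before [i] make a single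
    step, [i] jumps from its level to the full depth [K], the later ones are still whole, and the
    lower levels together with the [i] steps use up the [k] levels available. *)
Hypothesis bound : forall (i : 'I_n) lo hi,
  (forall j : 'I_n, (j < i)%N -> hi j = (lo j).+1) -> hi i = K ->
  (forall j : 'I_n, (i < j)%N -> lo j = 0%N /\ hi j = K) ->
  (\sum_j lo j + i = k)%N -> `|mixed_diff Phi lo hi| <= B.

(** Bounds the number of pieces that come from [p] coordinates still to be split when [e] levels
    remain. It is 0 for [p = 0]: a difference made of single steps only, within the [k] levels,
    vanishes by [exact]. *)
Let W (p e : nat) := if p is q.+1 then 'C(e + q, q) else 0%N.

(** Pascal's rule, after reversing the sum. The 1 counts the piece that stops at the current
    coordinate, the sum those that step from [d] to [d + 1] and go on with [e - d - 1] levels. *)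
Let W_rec p e : (1 + \sum_(d < e) W p (e - d.+1) <= W p.+1 e)%N.
Proof.
rewrite (reindex_inj rev_ord_inj) /=.
under eq_bigr => d _ do rewrite subnSK// subKn 1?ltnW//.
case: p => [|p] /=; first by rewrite big1// bin0.
elim: e => [|e IH]; first by rewrite big_ord0 add0n binn.
rewrite big_ord_recr /= addnA [(e.+1 + p.+1)%N]addSn binS leq_add//.
by rewrite leq_bin2l// addnS.
Qed.

Let sum_upd (L : 'I_n -> nat) i d : L i = 0%N ->
  (\sum_j upd L i d j = \sum_j L j + d)%N.
Proof.
move=> Li; rewrite (bigD1 i)//= [in RHS](bigD1 i)//= Li /upd eqxx add0n addnC.
by congr (_ + _)%N; apply: eq_bigr => j /negbTE ->.
Qed.

Let mixed_diff_levels lo hi i e : lo i = 0%N ->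
  mixed_diff Phi lo hi = mixed_diff Phi (upd lo i e) hi +
    \sum_(d < e) mixed_diff Phi (upd lo i d) (upd hi i d.+1).
Proof.
move=> lo0; elim: e => [|e IH].
  by rewrite big_ord0 addr0 -[in upd _ _ _]lo0 upd_same.
rewrite IH (mixed_diff_split _ (upd lo i e) hi i e.+1) upd_upd big_ord_recr /=.
ring.
Qed.

Let mixed_diff_rec p : forall i e lo hi, (i + p = n)%N ->
  (forall j : 'I_n, (j < i)%N -> hi j = (lo j).+1) ->
  (forall j : 'I_n, (i <= j)%N -> lo j = 0%N /\ hi j = K) ->
  (\sum_j lo j + i + e = k)%N ->
  `|mixed_diff Phi lo hi| <= (W p e)%:R * B.
Proof.
elim: p => [|p IH] i e lo hi ipn small big sum_k.
  (* Every coordinate makes a single step, so at each vertex the levels add up to [k] at most, and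
     [exact] cancels the terms in pairs. *)
  suff -> : mixed_diff Phi lo hi = 0 by rewrite normr0 mul0r.
  rewrite addn0 in ipn; subst i.
  rewrite (mixed_diff_pair _ _ _ (Ordinal n_gt0)) big1// => v _.
  suff H L : (forall j, L j <= (lo j).+1)%N -> (\sum_j L j <= k)%N.
    have E0 : (\sum_(j < n) 0 <= k)%N by rewrite big1.
    rewrite !(fun HL => exact HL E0) ?subrr ?mulr0//; apply: H => j.
      by rewrite /upd; case: eqP => [->|_] //; case: ifP => _ //; rewrite small.
    rewrite /upd; case: eqP => [->|_]; first by rewrite small.
    by case: ifP => _ //; rewrite small.
  move=> HL; apply: (@leq_trans (\sum_j (lo j + 1))).
    by apply: leq_sum => j _; rewrite addn1.
  by rewrite big_split /= sum_nat_const card_ord muln1 -sum_k leq_addr.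
have in_ : (i < n)%N by lia.
pose io := Ordinal in_.
have [lo0 hiK] : lo io = 0%N /\ hi io = K by exact: big.
rewrite (@mixed_diff_levels lo hi io e)//.
apply: (le_trans (ler_normD _ _)).
have : (1 + \sum_(d < e) W p (e - d.+1))%:R * B <= (W p.+1 e)%:R * B.
  by rewrite ler_wpM2r// ler_nat.
apply: le_trans; rewrite natrD mulrDl mul1r lerD//.
  apply: (bound (i := io)) => //.
  - by move=> j ji; rewrite /upd; case: eqP => [E|_]; [move: ji; rewrite E ltnn|exact: small].
  - move=> j ij; rewrite /upd; case: eqP => [E|_]; first by move: ij; rewrite E ltnn.
    exact/big/ltnW.
  - by rewrite sum_upd// addnAC.
rewrite natr_sum mulr_suml; apply: (le_trans (ler_norm_sum _ _ _)).
apply: ler_sum => d _; apply: (IH i.+1).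
- by rewrite addSnnS.
- move=> j; rewrite ltnS leq_eqVlt => /orP[/eqP ji|ji].
    by rewrite /upd (_ : j == io)//; apply/eqP/val_inj.
  rewrite /upd; case: eqP => [E|_]; last exact: small.
  by move: ji; rewrite E ltnn.
- move=> j ij; rewrite /upd; case: eqP => [E|_]; first by move: ij; rewrite E ltnn.
  exact/big/ltnW.
- by rewrite sum_upd// -sum_k -!addnA; congr (_ + _)%N; have := ltn_ord d; lia.
Qed.

Lemma telescoping_bound :
  `|mixed_diff Phi (fun=> 0%N) (fun=> K)| <= 'C(k + n.-1, n.-1)%:R * B.
Proof.
have -> : 'C(k + n.-1, n.-1) = W n k by rewrite /W; case: n n_gt0.
by apply: (@mixed_diff_rec n 0%N) => //; rewrite big1.
Qed.

End telescoping.

(** * Boxes of the b-adic grid *)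

Section horner_value.
Variable b : nat.
Implicit Types d : nat -> nat.

(** The most significant digit comes first: divided by b^K, this is the truncation to [K] digits of
    the base [b] fraction 0.d0 d1 d2 ... *)
Fixpoint horner_value d K : nat :=
  if K is L.+1 then (horner_value d L * b + d L)%N else 0%N.

Lemma horner_value_lt d K : (forall r, d r < b)%N -> (horner_value d K < b ^ K)%N.
Proof.
move=> db; elim: K => [|K IH] //=; rewrite expnSr.
apply: (@leq_trans ((horner_value d K).+1 * b)); last by rewrite leq_mul2r IH orbT.
by rewrite mulSn [leqRHS]addnC ltn_add2l.
Qed.

Lemma horner_value_div d L e : (forall r, d r < b)%N ->
  (horner_value d (L + e) %/ b ^ e = horner_value d L)%N.
Proof.
move=> db; have b0 : (0 < b)%N by apply: leq_ltn_trans (db 0%N).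
elim: e => [|e IH]; first by rewrite addn0 divn1.
by rewrite addnS /= expnS divnMA divnMDl// (divn_small (db _)) addn0.
Qed.

Lemma eq_horner_value d d' K : (forall r, (r < K)%N -> d r = d' r) ->
  horner_value d K = horner_value d' K.
Proof.
elim: K => //= K IH dd'; rewrite dd'// IH// => r rK.
exact/dd'/ltnW.
Qed.

Lemma horner_value_inj d d' K : (forall r, d r < b)%N -> (forall r, d' r < b)%N ->
  horner_value d K = horner_value d' K -> forall r, (r < K)%N -> d r = d' r.
Proof.
move=> db d'b; have b0 : (0 < b)%N by apply: leq_ltn_trans (db 0%N).
elim: K => //= K IH E.
have [E1 E2] : horner_value d K = horner_value d' K /\ d K = d' K.
  have := congr1 (divn^~ b) E; have := congr1 (modn^~ b) E.
  by rewrite /= !modnMDl !modn_small// !divnMDl// !(divn_small (db _)) !(divn_small (d'b _)) !addn0.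
by move=> r; rewrite ltnS leq_eqVlt => /orP[/eqP->|]; [|exact: IH].
Qed.

Lemma horner_value_series (R : realFieldType) d K : (0 < b)%N ->
  (horner_value d K)%:R / b%:R ^+ K = \sum_(r < K) (d r)%:R / b%:R ^+ r.+1 :> R.
Proof.
move=> b0; have b0' : b%:R != 0 :> R by rewrite pnatr_eq0 -lt0n.
elim: K => [|K IH]; first by rewrite big_ord0 mul0r.
rewrite big_ord_recr /= -IH natrD natrM mulrDl; congr (_ + _).
by rewrite exprS invfM mulrA -(mulrA _ b%:R) mulfV// mulr1.
Qed.

End horner_value.

Lemma esum_finType (R : realType) (X : finType) (P : pred X) (a : X -> \bar R) :
  (forall w, P w -> 0 <= a w)%E ->
  (\esum_(w in [set w | P w]) a w = \sum_(w | P w) a w)%E.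
Proof.
move=> a0; rewrite esum_fset => [||w]; [|exact: finite_finset|by rewrite inE; exact: a0].
by rewrite (@bigfs _ _ _ _ (index_enum X)) ?index_enum_uniq// => w _; rewrite mem_index_enum.
Qed.

Section grid.
Context (R : realType) (b n : nat) (jl : 'rV[int]_n * 'rV[int]_n) (K : nat).
Hypothesis b_gt1 : (1 < b)%N.
Implicit Types (c lo up : 'I_n -> nat) (x : 'rV[R]_n).

Definition grid_point c : 'rV[R]_n :=
  \row_i (b%:R ^ jl.1 0 i * ((jl.2 0 i)%:~R + (c i)%:R / b%:R ^+ K)).

Definition grid_box lo up := (grid_point lo, grid_point up).

(** Index of the grid cell containing [x], counted from the lower corner of the elementary box. It
    is an integer because points outside that box may have negative indices. *)
Definition grid_floor x (i : 'I_n) : int :=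
  Num.floor ((b%:R ^ (- jl.1 0 i) * x 0 i - (jl.2 0 i)%:~R) * b%:R ^+ K).

Let b_gt0 : 0 < b%:R :> R. Proof. by rewrite ltr0n ltnW. Qed.

Let bK_gt0 : 0 < b%:R ^+ K :> R. Proof. exact: exprn_gt0. Qed.

Let bj_gt0 j : 0 < (b%:R : R) ^ j. Proof. exact: exprz_gt0. Qed.

Let grid_point_le c x i : (grid_point c 0 i <= x 0 i) = ((c i)%:Z <= grid_floor x i).
Proof.
rewrite floor_ge_int -pmulrn mxE -ler_pdivrMr// lerBrDl.
by rewrite -invr_expz ler_pdivlMl.
Qed.

Let grid_point_gt c x i : (x 0 i < grid_point c 0 i) = (grid_floor x i < (c i)%:Z).
Proof. by rewrite !ltNge grid_point_le. Qed.

(** Inclusion and disjointness of half-open boxes with vertices on the grid thereby reduce to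
    integer inequalities between cell indices. *)
Lemma mem_grid_box lo up x :
  box (grid_box lo up) x <->
  forall i, (lo i)%:Z <= grid_floor x i < (up i)%:Z.
Proof.
by split=> H i; have := H i; rewrite /= grid_point_le grid_point_gt.
Qed.

Lemma elem_box_grid : elem_box b jl = box (grid_box (fun=> 0%N) (fun=> (b ^ K)%N)).
Proof.
rewrite /elem_box; congr (box (_, _)); apply/rowP => i; rewrite !mxE.
  by rewrite mul0r addr0.
by rewrite natrX mulfV ?gt_eqF// intrD.
Qed.

Lemma mem_elem_box_grid x : elem_box b jl x ->
  exists2 c, forall i, (c i < b ^ K)%N & forall i, grid_floor x i = (c i)%:Z.
Proof.
rewrite elem_box_grid => /mem_grid_box H.
exists (fun i => `|grid_floor x i|%N) => i; have /andP[f0 fb] := H i.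
  by rewrite -ltz_nat gez0_abs.
by rewrite gez0_abs.
Qed.

Lemma grid_floor_point c i : grid_floor (grid_point c) i = (c i)%:Z.
Proof.
apply/floor_def; rewrite mxE -invr_expz mulKf ?gt_eqF// addrAC subrr add0r.
by rewrite divfK ?gt_eqF// pmulrn lexx /= intrD ltrDl ltr01.
Qed.

Lemma grid_box_volume lo up : box_volume (grid_box lo up) =
  \prod_i (b%:R ^ jl.1 0 i * ((up i)%:R - (lo i)%:R) / b%:R ^+ K).
Proof.
by apply: eq_bigr => i _; rewrite !mxE -mulrBr opprD addrACA subrr add0r -mulrBl mulrA.
Qed.

Lemma grid_box_volume_gt0 lo up : (forall i, lo i < up i)%N ->
  0 < box_volume (grid_box lo up).
Proof.
move=> lu; rewrite grid_box_volume; apply: prodr_gt0 => i _.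
by rewrite divr_gt0// mulr_gt0// subr_gt0 ltr_nat.
Qed.

Definition box_term (alpha : R) (g : 'rV[R]_n -> R) (I : 'rV[R]_n * 'rV[R]_n) : R :=
  box_volume I * (`|box_difference g I| / box_volume I `^ alpha) ^+ 2.

(* Disjoint boxes with vertices on the grid extend to a partition: the cells
   of the grid contained in none of them are added. *)
Lemma sum_box_term_le (X : finType) (P : pred X) (lo up : X -> 'I_n -> nat)
    (alpha gamma : R) (g : 'rV[R]_n -> R) :
  (forall w i, P w -> (lo w i < up w i <= b ^ K)%N) ->
  (forall w w' (c : 'I_n -> nat), P w -> P w' -> (forall i, lo w i <= c i < up w i)%N ->
     (forall i, lo w' i <= c i < up w' i)%N -> w = w') ->
  0 <= gamma ->
  (variation_alpha alpha (elem_box b jl) g <= gamma%:E)%E ->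
  \sum_(w | P w) box_term alpha g (grid_box (lo w) (up w)) <= gamma ^+ 2.
Proof.
move=> lu disj g0 V.
pose inw c w := P w /\ forall i, (lo w i <= c i < up w i)%N.
pose cell c := grid_box c (fun i => (c i).+1).
pose Q := [set grid_box (lo w) (up w) | w in [set w | P w]] `|`
  [set cell c | c in [set c | (forall i, c i < b ^ K)%N /\ ~ exists w, inw c w]].
have boxw w x : P w -> box (grid_box (lo w) (up w)) x ->
    exists2 c, inw c w & forall i, grid_floor x i = (c i)%:Z.
  move=> Pw /mem_grid_box H; exists (fun i => `|grid_floor x i|%N).
    split=> // i; have /andP[H1 H2] := H i.
    by rewrite -lez_nat -ltz_nat gez0_abs ?H1//; exact: le_trans H1.
  by move=> i; have /andP[H1 H2] := H i; rewrite gez0_abs//; exact: le_trans H1.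
have boxc c x : box (cell c) x <-> forall i, grid_floor x i = (c i)%:Z.
  rewrite mem_grid_box; split => H i; have := H i; last by move=> ->; lia.
  by lia.
have inwbox c w x : inw c w -> (forall i, grid_floor x i = (c i)%:Z) ->
    box (grid_box (lo w) (up w)) x.
  by move=> [_ H] E; apply/mem_grid_box => i; rewrite E lez_nat ltz_nat H.
have eqc (c c' : 'I_n -> nat) x : (forall i, grid_floor x i = (c i)%:Z) ->
    (forall i, grid_floor x i = (c' i)%:Z) -> c = c'.
  by move=> E E'; apply/funext => i; have := E i; rewrite E' => -[].
have partQ : partition Q (@box R n) (elem_box b jl).
  split.
  - apply/seteqP; split => [x [I] QI|x Jx].
      rewrite elem_box_grid; case: QI => [[w /= Pw <-]|[c [cK nc] <-]].
        move=> /(boxw _ _ Pw)[c [_ Hc] E]; apply/mem_grid_box => i.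
        rewrite E ltz_nat /=; have /andP[_ Hc2] := Hc i; have /andP[_ ub] := lu w i Pw.
        exact: leq_trans Hc2 ub.
      by move=> /boxc E; apply/mem_grid_box => i; rewrite E ltz_nat cK.
    have [c cK E] := mem_elem_box_grid Jx.
    have [[w cw]|nw] := pselect (exists w, inw c w).
      exists (grid_box (lo w) (up w)); last exact: inwbox cw E.
      by left; exists w => //; case: cw.
    exists (cell c); last exact/boxc.
    by right; exists c.
  - move=> I I' [[w /= Pw <-]|[c [cK nc] <-]] [[w' /= Pw' <-]|[c' [cK' nc'] <-]]
      [x [Ix I'x]].
    + have [c [_ Hc] E] := boxw _ _ Pw Ix; have [c' [_ Hc'] E'] := boxw _ _ Pw' I'x.
      by rewrite (disj w w' c)// (eqc c c' x).
    + have [c Hc E] := boxw _ _ Pw Ix; move/boxc : I'x => E'.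
      by case: nc'; exists w; rewrite (eqc c' c x).
    + have [c' Hc' E'] := boxw _ _ Pw' I'x; move/boxc : Ix => E.
      by case: nc; exists w'; rewrite (eqc c c' x).
    + by move/boxc : Ix => E; move/boxc : I'x => E'; rewrite (eqc c c' x).
  - move=> I [[w /= Pw <-]|[c [cK nc] <-]].
      exists (grid_point (lo w)); apply/mem_grid_box => i; rewrite grid_floor_point lexx /=.
      by rewrite ltz_nat; case/andP: (lu w i Pw).
    by exists (grid_point c); apply/boxc => i; rewrite grid_floor_point.
have Q0 I : Q I -> (0 <= (box_term alpha g I)%:E)%E.
  move=> QI; rewrite lee_fin mulr_ge0// ?sqr_ge0//.
  case: QI => [[w /= Pw <-]|[c [cK nc] <-]]; apply/ltW/grid_box_volume_gt0 => i //.
  by case/andP: (lu w i Pw).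
have : (\esum_(I in Q) (box_term alpha g I)%:E <= (gamma ^+ 2)%:E)%E.
  have S0 : (0 <= \esum_(I in Q) (box_term alpha g I)%:E)%E by exact: esum_ge0.
  have : (poweR (\esum_(I in Q) (box_term alpha g I)%:E) 2^-1 <= gamma%:E)%E.
    by apply: le_trans V; apply: ereal_sup_ubound; exists Q.
  case: (\esum_(I in Q) _)%E S0 => [S|//|//].
    rewrite lee_fin poweR_EFin !lee_fin => S0 Sg.
    rewrite -[S]sqr_sqrtr// -powR12_sqrt// ler_pXn2r// ?nnegrE ?powR_ge0//.
  by rewrite poweRyr// => _; rewrite leye_eq.
rewrite -lee_fin; apply: le_trans.
(* Two indices with the same box would share the cell at its lower corner, against disjointness.
   Hence no term is lost when the finite sum becomes a sum over a set of boxes. *)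
have injP : set_inj [set w | P w] (fun w => grid_box (lo w) (up w)).
  move=> w w'; rewrite !inE /= => Pw Pw' E.
  have luw i : (lo w i < up w i)%N by case/andP: (lu w i Pw).
  have : box (grid_box (lo w) (up w)) (grid_point (lo w)).
    by apply/mem_grid_box => i; rewrite grid_floor_point lexx ltz_nat luw.
  rewrite {1}E => /(boxw _ _ Pw')[c [_ Hc] Ec].
  have cE : lo w = c by apply: eqc Ec => i; rewrite grid_floor_point.
  by apply: (disj w w' (lo w)) => // i; rewrite ?cE// -cE leqnn luw.
rewrite (esumID [set grid_box (lo w) (up w) | w in [set w | P w]])//.
rewrite [X in \esum_(_ in X) _ + _](_ : _ =
  [set grid_box (lo w) (up w) | w in [set w | P w]]); last first.
  by apply/seteqP; split => [I []//|I AI]; split => //; left.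
rewrite esum_image// esum_finType => [|w Pw]; last by apply: Q0; left; exists w.
by rewrite sumEFin leeDl//; apply: esum_ge0 => I [/Q0].
Qed.

End grid.

(** A change of the digit at position [r] moves the value by that change times b^e, since [e] digits
    follow. The additive form avoids truncated subtraction. *)
Lemma horner_value_update b (d d' : nat -> nat) r e :
  (forall r', r' != r -> d r' = d' r') ->
  (horner_value b d (r.+1 + e) + d' r * b ^ e =
   horner_value b d' (r.+1 + e) + d r * b ^ e)%N.
Proof.
move=> dd'; elim: e => [|e IH].
  rewrite addn0 /= !muln1 (@eq_horner_value _ d d') => [|r' r'r]; last first.
    by apply: dd'; rewrite neq_ltn r'r.
  lia.
have E : d (r.+1 + e)%N = d' (r.+1 + e)%N by apply: dd'; lia.
have hS f : horner_value b f (r.+1 + e.+1) = (horner_value b f (r.+1 + e) * b + f (r.+1 + e))%N.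
  by rewrite addnS.
by rewrite !hS E expnSr !mulnA addnAC -mulnDl IH mulnDl addnAC.
Qed.

(** * Arrays of digits and equidistribution *)

Section digit_arrays.
Context (b K : nat).

Definition digit_array n := {ffun 'I_n * 'I_K -> 'F_b}.

(** The default 0 at positions from [K] on yields a total sequence, as [horner_value] expects. *)
Definition digit n (a : digit_array n) (i : 'I_n) (r : nat) : nat :=
  if insub r is Some r' then a (i, r') else 0%N.

Definition digit_value n (a : digit_array n) (i : 'I_n) : nat :=
  horner_value b (digit a i) K.

Definition digit_point (R : realType) n (jl : 'rV[int]_n * 'rV[int]_n)
  (a : digit_array n) : 'rV[R]_n := grid_point R b jl K (digit_value a).

(** Fixing the digits at these positions fixes an elementary box whose order is the sum of the
    levels (as long as no level exceeds [K]). *)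
Definition prefix_set n (L : 'I_n -> nat) : {set 'I_n * 'I_K} :=
  [set p : 'I_n * 'I_K | (p.2 < L p.1)%N]%SET.

Lemma digit_mix n (L : 'I_n -> nat) (a z : digit_array n) i r :
  digit (mix (prefix_set L) a z) i r = if (r < L i)%N then digit a i r else digit z i r.
Proof.
rewrite /digit; case: insubP => [r' _ <-|]; last by case: ifP.
by rewrite ffunE inE /=; case: ifP.
Qed.

Lemma digit_ord n (a : digit_array n) i (r : 'I_K) : digit a i r = a (i, r).
Proof. by rewrite /digit valK. Qed.

(** The net property in digit form: functions of the elementary box of order at most [k] have the
    same average over the family as over the whole grid. For a digital net [k] is m - t. *)
Definition equidistributed (R : realFieldType) n (V : finType)
    (A : V -> digit_array n) (k : nat) :=
  forall (L : 'I_n -> nat) (h : digit_array n -> R), (\sum_i L i <= k)%N ->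
    (forall a z, h (mix (prefix_set L) a z) = h a) ->
    avg (fun v => h (A v)) = avg h.

Hypothesis b_prime : prime b.

Lemma digit_lt n (a : digit_array n) i r : (digit a i r < b)%N.
Proof.
rewrite /digit; case: insub => [r'|]; last exact: prime_gt0.
by rewrite -[ltnRHS](Fp_cast b_prime) ltn_ord.
Qed.

Lemma card_prefix_digits n (L : 'I_n -> nat) : (forall i, L i <= K)%N ->
  #|{ffun {p | p \in prefix_set L} -> 'F_b}| = (b ^ \sum_i L i)%N.
Proof.
move=> LK; rewrite card_ffun card_Fp// card_sig; congr (b ^ _)%N.
rewrite -sum1_card (eq_bigl (fun p : 'I_n * 'I_K => true && (p.2 < L p.1)%N)); last first.
  by move=> p; rewrite inE.
rewrite -(pair_big_dep xpredT (fun i (r : 'I_K) => (r < L i)%N) (fun _ _ => 1%N)) /=.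
apply: eq_bigr => i _; rewrite sum1_card.
have wi : injective (widen_ord (LK i)) by move=> x y /(congr1 val) /= /val_inj.
rewrite -[RHS]card_ord -(card_imset _ wi); apply: eq_card => r.
rewrite unfold_in; apply/idP/imsetP => [rL|[r' _ ->]]; last exact: (ltn_ord r').
by exists (Ordinal rL) => //; apply/val_inj.
Qed.

End digit_arrays.

(** * Mixed differences over a net *)

Lemma powR_sqr_half (R : realType) (x y : R) : (x `^ (y / 2)) ^+ 2 = x `^ y.
Proof. by rewrite -powR_mulrn ?powR_ge0// -powRrM divfK. Qed.

Section cell_estimate.
Context (R : realType) (b n K : nat) (jl : 'rV[int]_n * 'rV[int]_n).
Context (g : 'rV[R]_n -> R) (alpha gamma : R).
Hypothesis b_prime : prime b.
Hypothesis alpha_gt : 2^-1 < alpha.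
Hypothesis gamma_ge0 : 0 <= gamma.
Hypothesis variation_le : (variation_alpha alpha (elem_box b jl) g <= gamma%:E)%E.

Let alpha2_ge0 : 0 <= 2 * alpha - 1. Proof. by rewrite subr_ge0 mulrC -ler_pdivrMr// mul1r ltW. Qed.

Let array := digit_array b K n.
Implicit Types (a z : array) (lo hi L : 'I_n -> nat).

Let b_gt1 : (1 < b)%N := prime_gt1 b_prime.
Let b_gt0R : 0 < b%:R :> R. Proof. by rewrite ltr0n prime_gt0. Qed.

(** In each coordinate, level 0 leaves the digits of [z] and level [K] gives those of [a]. *)
Definition digit_vertex L a z : 'rV[R]_n := digit_point R jl (mix (prefix_set K L) a z).

Definition level_diff lo hi a z : R :=
  mixed_diff (fun L => g (digit_vertex L a z)) lo hi.

Let value L a z i : nat := digit_value (mix (prefix_set K L) a z) i.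

Let lower lo hi a z i := minn (value lo a z i) (value hi a z i).
Let upper lo hi a z i := maxn (value lo a z i) (value hi a z i).

(** The coordinate [i] of a vertex depends on the level in direction [i] alone; this is why the
    vertices over mixed levels are those of a genuine box. *)
Let value_local L L' a z i : L i = L' i -> value L a z i = value L' a z i.
Proof. by move=> E; apply: eq_horner_value => r _; rewrite !digit_mix E. Qed.

(** The higher level need not give the larger coordinate. Sorting the end points changes the
    difference only by a sign. *)
Let level_diff_box lo hi a z :
  `|level_diff lo hi a z| =
  `|box_difference g (grid_box R b jl K (lower lo hi a z) (upper lo hi a z))|.
Proof.
pose S := [set i | (value hi a z i < value lo a z i)%N]%SET.
rewrite /level_diff.
transitivity `|mixed_diff (fun c : 'I_n -> nat => g (grid_point R b jl K c))
   (value lo a z) (value hi a z)|.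
  congr `| _ |; apply: eq_bigr => v _; congr (_ * g _); apply/rowP => i; rewrite !mxE.
  by case: ifP => iv; rewrite -(@value_local (fun i => if i \in v then lo i else hi i))// iv.
rewrite -(normr_mixed_diff_swap _ _ _ S); congr `| _ |; apply: eq_bigr => v _.
congr (_ * g _); apply/rowP => i; rewrite !mxE /lower /upper !inE /=.
by case: ifP => iv; case: ltnP.
Qed.

Let value_div lo L a z i : (lo i <= L i)%N -> (lo i <= K)%N ->
  (value L a z i %/ b ^ (K - lo i) = horner_value b (digit a i) (lo i))%N.
Proof.
move=> loL loK; rewrite /value /digit_value -[X in horner_value b _ X](subnKC loK) horner_value_div; last first.
  by move=> r; exact: digit_lt.
by apply: eq_horner_value => r rlo; rewrite digit_mix (leq_trans rlo loL).
Qed.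

Let value_lt L a z i : (value L a z i < b ^ K)%N.
Proof. by apply: horner_value_lt => r; exact: digit_lt. Qed.

Let prefix lo a : {ffun {p | p \in prefix_set K lo} -> 'F_b} := [ffun p => a (val p)].

Variables (lo hi : 'I_n -> nat) (side : 'I_n -> R).
Hypothesis lo_hi : forall i, (lo i <= hi i)%N.
Hypothesis hi_K : forall i, (hi i <= K)%N.
(** Two bounds for a relative side length: lying in an elementary interval of level [lo] gives the
    first, a change of a single digit the second. The choice is left open because for a single step
    both are valid. *)
Hypothesis sideP : forall i, side i = b%:R ^- lo i \/
  (hi i = (lo i).+1 /\ side i = (b%:R - 1) * b%:R ^- hi i).

Let lo_K i : (lo i <= K)%N. Proof. exact: leq_trans (lo_hi i) (hi_K i). Qed.

Let side_ge a z i :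
  ((upper lo hi a z i)%:R - (lower lo hi a z i)%:R) / b%:R ^+ K <= side i :> R.
Proof.
rewrite ler_pdivrMr ?exprn_gt0//.
have -> : (upper lo hi a z i)%:R - (lower lo hi a z i)%:R =
    (upper lo hi a z i - lower lo hi a z i)%:R :> R.
  by rewrite natrB// geq_min leq_max leqnn.
have bE k : (k <= K)%N -> b%:R ^- k * b%:R ^+ K = (b ^ (K - k))%:R :> R.
  move=> kK; rewrite natrX -{1}(subnK kK) exprD mulrC mulfK// gt_eqF// exprn_gt0//.
have [->|[hlo ->]] := sideP i.
  (* Both values begin with the first [lo i] digits of [a], so they have the same quotient by b^(K -
     lo i) and differ by less than that. *)
  rewrite bE// ler_nat.
  have B0 : (0 < b ^ (K - lo i))%N by rewrite expn_gt0 ltnW.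
  have := divn_eq (value lo a z i) (b ^ (K - lo i)).
  have := divn_eq (value hi a z i) (b ^ (K - lo i)).
  rewrite !value_div// /upper /lower.
  have := ltn_pmod (value lo a z i) B0; have := ltn_pmod (value hi a z i) B0.
  move: (value lo a z i) (value hi a z i) => v v'.
  by move: (_ * b ^ (K - lo i))%N => q; lia.
rewrite -mulrA bE// -(natrB _ (ltnW b_gt1)) -natrM ler_nat.
have hK := hi_K i.
(* The two values differ only in the digit at position [lo i], which comes from [z] at level [lo i]
   and from [a] at level [hi i]. *)
have : (value lo a z i + digit (mix (prefix_set K hi) a z) i (lo i) * b ^ (K - hi i) =
  value hi a z i + digit (mix (prefix_set K lo) a z) i (lo i) * b ^ (K - hi i))%N.
  have KE d : horner_value b d K = horner_value b d ((lo i).+1 + (K - hi i)).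
    by rewrite -hlo subnKC.
  rewrite /value /digit_value !KE.
  apply: horner_value_update => r rlo; rewrite !digit_mix hlo ltnS (leq_eqVlt r).
  by rewrite (negbTE rlo).
rewrite /upper /lower.
have := digit_lt b_prime (mix (prefix_set K lo) a z) i (lo i).
have := digit_lt b_prime (mix (prefix_set K hi) a z) i (lo i).
move: (digit _ _ _) (digit _ _ _) (value lo a z i) (value hi a z i) => d' d v v'.
by move: (b ^ (K - hi i))%N => B d'b db E; nia.
Qed.

Let T a z : R := `|level_diff lo hi a z|.

(** The whole box stays in the elementary box determined by the leading digits of [a], so boxes with
    different prefixes share no cell. *)
Let box_sub a z i (c : nat) : (lower lo hi a z i <= c < upper lo hi a z i)%N ->
  (c %/ b ^ (K - lo i) = horner_value b (digit a i) (lo i))%N.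
Proof.
have := @value_div lo lo a z i (leqnn _) (lo_K i).
have := @value_div lo hi a z i (lo_hi i) (lo_K i).
rewrite /upper /lower; move: (value lo a z i) (value hi a z i) => v v' E' E /andP[l u].
apply/eqP; rewrite eqn_leq; apply/andP; split.
  have [cv|vc] := leqP c v; first by rewrite -E leq_div2r.
  by rewrite -E' leq_div2r//; lia.
have [vc|cv] := leqP v c; first by rewrite -E leq_div2r.
by rewrite -E' leq_div2r//; lia.
Qed.

Let volume := \prod_i ((b%:R : R) ^ jl.1 0 i).

Let side_ge0 i : 0 <= side i.
Proof.
have [->|[_ ->]] := sideP i; first by rewrite invr_ge0 exprn_ge0.
by rewrite mulr_ge0 ?invr_ge0 ?exprn_ge0// subr_ge0 ler1n ltnW.
Qed.

Let box_volume_le a z :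
  box_volume (grid_box R b jl K (lower lo hi a z) (upper lo hi a z)) <=
  volume * \prod_i side i.
Proof.
rewrite grid_box_volume -big_split /=; apply: ler_prod => i _.
have bj : 0 < (b%:R : R) ^ jl.1 0 i by exact: exprz_gt0.
rewrite -mulrA ler_pM2l// side_ge andbT mulr_ge0 ?(ltW bj)// divr_ge0 ?exprn_ge0//.
by rewrite subr_ge0 ler_nat geq_min leq_max leqnn.
Qed.

(** The squared difference is Vol^(2 alpha - 1) times the term of the variation. As 2 alpha - 1 >=
    0, the volume in this factor may be replaced by its upper bound. *)
Let T_sqr_le a z : (forall i, lower lo hi a z i < upper lo hi a z i)%N ->
  T a z ^+ 2 <= (volume * \prod_i side i) `^ (2 * alpha - 1) *
  box_term alpha g (grid_box R b jl K (lower lo hi a z) (upper lo hi a z)).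
Proof.
move=> lu; rewrite /T level_diff_box /box_term; set I := grid_box _ _ _ _ _ _.
set t := `|_|; set v := box_volume I.
have I0 : 0 < v by exact: grid_box_volume_gt0.
apply: (@le_trans _ _ (v `^ (2 * alpha - 1) * (v * (t / v `^ alpha) ^+ 2))).
  rewrite mulrA expr_div_n -[v `^ alpha ^+ 2]powR_mulrn ?powR_ge0// -powRrM.
  rewrite -{2}(powRr1 (ltW I0)) -powRD; last by apply/implyP => _; rewrite gt_eqF.
  rewrite (_ : 2 * alpha - 1 + 1 = alpha * 2); last by ring.
  by rewrite mulrCA mulfV ?mulr1// gt_eqF// powR_gt0.
apply: ler_wpM2r; first by rewrite mulr_ge0 ?sqr_ge0// ltW.
by apply: ge0_ler_powR; rewrite ?nnegrE ?(ltW I0) ?box_volume_le//;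
  exact: le_trans (ltW I0) (box_volume_le a z).
Qed.

Lemma level_diff_avg_le (V : finType) (A : V -> array) (k : nat) z :
  equidistributed R A k -> (\sum_i lo i <= k)%N ->
  `|avg (fun v => level_diff lo hi (A v) z)| <=
  gamma * b%:R `^ (- (\sum_i lo i)%:R / 2) *
  (volume * \prod_i side i) `^ (alpha - 2^-1).
Proof.
move=> eqA lok.
set W := prefix_set K lo; pose X := {ffun {p | p \in W} -> 'F_b}.
(* [T] also sees digits of [a] beyond [lo]. Its maximum over the arrays with prefix [w] depends on
   [w] only, and a maximiser supplies the box attached to [w]. *)
have bestP (w : X) : exists a : array, prefix lo a = w /\
    forall a', prefix lo a' = w -> T a' z <= T a z.
  pose a0 : array := [ffun p => if insub p is Some p' then w p' else 0].
  have a0w : prefix lo a0 == w.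
    by apply/eqP/ffunP => p; rewrite !ffunE valK.
  have [a /eqP aw amax] := @Order.TotalTheory.arg_maxP _ _ _ a0
    (fun a => prefix lo a == w) (T^~ z) a0w.
  by exists a; split => // a' /eqP; exact: amax.
have [best {}bestP] := choice bestP.
pose M w := T (best w) z.
have M0 w : 0 <= M w by exact: normr_ge0.
have avgM : avg (fun v => T (A v) z) <= avg M.
  apply: (@le_trans _ _ (avg (fun v => M (prefix lo (A v))))).
    by apply: ler_avg => v; have [_] := bestP (prefix lo (A v)); apply.
  rewrite (eqA lo (fun a => M (prefix lo a)))//; last first.
    move=> a z'; congr M; apply/ffunP => p; rewrite !ffunE.
    by rewrite (valP p).
  by rewrite (avg_restrict z M)//; exact: val_inj.
(* Boxes with an empty side cannot belong to a partition. For them [M w = 0], so they may be left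
   out of the sum of squares. *)
pose P w := M w != 0.
have Plu w i : P w -> (lower lo hi (best w) z i < upper lo hi (best w) z i)%N.
  apply: contraNltn => ul; rewrite /M /T (_ : level_diff _ _ _ _ = 0) ?normr0//.
  apply/eqP; rewrite -normr_eq0 level_diff_box normr_eq0; apply/eqP.
  apply: (@mixed_diff_degenerate _ _ _ (fun c => g (\row_i c i)) _ _ i).
  rewrite !mxE; congr (_ * (_ + _%:R / _)); apply/eqP; rewrite eqn_leq ul andbT.
  by rewrite geq_min leq_max leqnn.
have sumM : \sum_w M w ^+ 2 <= (volume * \prod_i side i) `^ (2 * alpha - 1) * gamma ^+ 2.
  have Vg := @sum_box_term_le R b n jl K b_gt1 X P (fun w => lower lo hi (best w) z)
    (fun w => upper lo hi (best w) z) alpha gamma g.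
  rewrite (bigID P) /= [X in _ + X]big1 ?addr0; last first.
    by move=> w; rewrite negbK => /eqP ->; rewrite expr0n.
  apply: le_trans (ler_wpM2l (powR_ge0 _ _) (Vg _ _ gamma_ge0 variation_le)).
  - rewrite mulr_sumr; apply: ler_sum => w Pw; apply: T_sqr_le => i; exact: Plu.
  - by move=> w i Pw; rewrite Plu//= /upper geq_max !(ltnW (value_lt _ _ _ _)).
  - move=> w w' c _ _ cw cw'; apply/ffunP => p.
    have [<- _] := bestP w; have [<- _] := bestP w'; rewrite !ffunE.
    case: (val p) (valP p) => i r; rewrite inE /= => rlo.
    have := box_sub (cw i); rewrite (box_sub (cw' i)) => E.
    apply/esym/val_inj => /=; rewrite -!digit_ord.
    by apply: (horner_value_inj _ _ E) => // r'; exact: digit_lt.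
apply: (le_trans (ler_norm_avg _)); apply: (le_trans avgM).
rewrite -(@ler_pXn2r _ 2)// ?nnegrE; [|by apply: divr_ge0 => //; apply: sumr_ge0|
  by rewrite !mulr_ge0 ?powR_ge0//].
apply: (le_trans (sqr_avg_le _)).
(* The number of prefixes, [b] to the sum of the lower levels, divides the sum of squares; its
   square root is the power of [b] in the claim. *)
rewrite /avg card_prefix_digits// ler_pdivrMr; last by rewrite ltr0n expn_gt0 prime_gt0.
apply: (le_trans sumM); rewrite !exprMn powR_sqr_half.
rewrite (_ : alpha - 2^-1 = (2 * alpha - 1) / 2); last by field.
rewrite powR_sqr_half natrX -[b%:R ^+ _]powR_mulrn ?ler0n//.
have bb (q : R) : b%:R `^ (- q) * b%:R `^ q = 1.
  by rewrite powRN mulVf// gt_eqF// powR_gt0.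
set q := (\sum_i lo i)%:R; set v := _ `^ (2 * alpha - 1).
rewrite (_ : _ * _ * v * _ = v * gamma ^+ 2 * (b%:R `^ (- q) * b%:R `^ q)); last by ring.
by rewrite bb mulr1.
Qed.

End cell_estimate.

Lemma mixed_diff_avg (R : realFieldType) (X : finType) (Y : Type) n
    (Phi : X -> ('I_n -> Y) -> R) (lo hi : 'I_n -> Y) :
  mixed_diff (fun L => avg (fun x => Phi x L)) lo hi =
  avg (fun x => mixed_diff (Phi x) lo hi).
Proof.
by rewrite /mixed_diff avg_sum; apply: eq_bigr => v _; rewrite avgZ.
Qed.

Lemma powR_ge1 (R : realType) (a x : R) : 1 <= a -> 0 <= x -> 1 <= a `^ x.
Proof. by move=> a1 x0; rewrite -[leLHS](powRr0 a) ler_powR. Qed.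

Section net_estimate.
Context (R : realType) (b n K k : nat) (jl : 'rV[int]_n * 'rV[int]_n).
Context (g : 'rV[R]_n -> R) (alpha gamma : R).
Hypothesis b_prime : prime b.
Hypothesis alpha_gt : 2^-1 < alpha.
Hypothesis gamma_ge0 : 0 <= gamma.
Hypothesis variation_le : (variation_alpha alpha (elem_box b jl) g <= gamma%:E)%E.
Hypothesis n_gt0 : (0 < n)%N.
Hypothesis kK : (k < K)%N.

Let b_gt1 : (1 < b)%N := prime_gt1 b_prime.
Let b_gt0R : 0 < b%:R :> R. Proof. by rewrite ltr0n prime_gt0. Qed.
Let b1_gt0R : 0 < b%:R - 1 :> R. Proof. by rewrite subr_gt0 ltr1n. Qed.
Let b1_ge1R : 1 <= b%:R - 1 :> R. Proof. by rewrite lerBrDr -[1 + 1]/(2%:R) ler_nat. Qed.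

(** Interpolates between the average of [g] over the grid, at level 0 in all coordinates, and its
    average over the net, at level [K]. Under equidistribution it remains the grid average while the
    levels add up to [k] at most. *)
Definition level_average (V : finType) (A : V -> digit_array b K n) (L : 'I_n -> nat) : R :=
  avg (fun v => avg (fun z => g (digit_vertex R jl L (A v) z))).

(** The cost of one coordinate that makes a single step: b^(1/2) because it takes one level away
    from the count of elementary boxes, (b-1)^(alpha-1/2) through the length of its side. *)
Definition net_step : R := b%:R `^ (2^-1) * (b%:R - 1) `^ (alpha - 2^-1).

(** The exponent [n.-1] is the largest number of coordinates that can precede the one where the
    telescoping stops. *)
Definition net_bound : R :=
  gamma * (\prod_i (b%:R : R) ^ jl.1 0 i) `^ (alpha - 2^-1) *
  b%:R `^ (- (alpha * k%:R)) * net_step ^+ n.-1.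

Let net_step_ge1 : 1 <= net_step.
Proof.
rewrite -[1]mulr1 ler_pM//; apply: powR_ge1.
- by rewrite ler1n ltnW.
- by rewrite invr_ge0.
- by [].
- by rewrite subr_ge0 ltW.
Qed.

Let net_bound_ge0 : 0 <= net_bound.
Proof.
rewrite /net_bound !mulr_ge0 ?powR_ge0// exprn_ge0//.
exact: le_trans ler01 net_step_ge1.
Qed.

Let step_bound (i : 'I_n) (lo hi : 'I_n -> nat) (side : 'I_n -> R) :
  (forall j, side j = if (j < i)%N then (b%:R - 1) * b%:R ^- hi j else b%:R ^- lo j) ->
  (forall j : 'I_n, (j < i)%N -> hi j = (lo j).+1) ->
  (forall j : 'I_n, (i < j)%N -> lo j = 0%N /\ hi j = K) ->
  (\sum_j lo j + i = k)%N ->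
  gamma * b%:R `^ (- (\sum_j lo j)%:R / 2) *
    ((\prod_j (b%:R : R) ^ jl.1 0 j) * \prod_j side j) `^ (alpha - 2^-1) <= net_bound.
Proof.
move=> sideE small big sumk.
(* The single steps enter with level [lo j + 1], the other coordinates with [lo j]. These add up to
   [k], so the power of [b] is the same wherever the telescoping stops. *)
have sidek : \prod_j side j = (b%:R - 1) ^+ i * b%:R ^- k.
  transitivity (\prod_(j < n) ((if (j < i)%N then b%:R - 1 else 1 : R) *
     b%:R ^- (lo j + (j < i)%N))).
    apply: eq_bigr => j _; rewrite sideE; case: ifP => ji.
      by rewrite small// addn1.
    by rewrite mul1r addn0.
  rewrite big_split /= -big_mkcond /= prodr_const.
  have cardi : #|[pred j : 'I_n | (j < i)%N]| = i.
    by rewrite -sum1_card -[RHS]subn0 -[RHS]muln1 -sum_nat_const_nat big_mkord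
      (big_ord_widen_cond n xpredT (fun _ => 1%N)) ?(ltnW (ltn_ord i)).
  congr (_ ^+ _ * _); first by rewrite -[RHS]cardi.
  rewrite prodfV prodrXr; congr (_ ^- _).
  rewrite big_split /= -[RHS]sumk; congr (_ + _)%N.
  by rewrite -[RHS]cardi -sum1_card [RHS]big_mkcond /=; apply: eq_bigr => j _; rewrite inE; case: (j < i)%N.
rewrite sidek.
have prodj0 : 0 <= \prod_j (b%:R : R) ^ jl.1 0 j.
  by apply: prodr_ge0 => j _; exact: exprz_ge0.
rewrite powRM ?mulr_ge0 ?invr_ge0 ?exprn_ge0 ?(ltW b1_gt0R) ?(ltW b_gt0R)//.
rewrite powRM ?invr_ge0 ?exprn_ge0 ?(ltW b1_gt0R) ?(ltW b_gt0R)//.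
rewrite /net_bound.
have -> : gamma * b%:R `^ (- (\sum_j lo j)%:R / 2) *
  ((\prod_j (b%:R : R) ^ jl.1 0 j) `^ (alpha - 2^-1) *
   (((b%:R - 1) ^+ i) `^ (alpha - 2^-1) * (b%:R ^- k) `^ (alpha - 2^-1))) =
  gamma * (\prod_j (b%:R : R) ^ jl.1 0 j) `^ (alpha - 2^-1) * (b%:R `^ (- (alpha * k%:R))) *
  net_step ^+ i.
  have -> : (b%:R ^- k) `^ (alpha - 2^-1) = b%:R `^ (- k%:R * (alpha - 2^-1)) :> R.
    by rewrite -powR_mulrn ?ler0n// -powRN -powRrM.
  have -> : ((b%:R - 1) ^+ i) `^ (alpha - 2^-1) = ((b%:R - 1) `^ (alpha - 2^-1)) ^+ i :> R.
    by rewrite -(powR_mulrn i (ltW b1_gt0R)) -(powR_mulrn i (powR_ge0 _ _)) -!powRrM mulrC.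
  rewrite /net_step exprMn.
  have -> : b%:R `^ (2^-1) ^+ i = b%:R `^ (i%:R / 2) :> R.
    by rewrite -powR_mulrn ?powR_ge0// -powRrM mulrC.
  have bD x y : (b%:R : R) `^ (x + y) = b%:R `^ x * b%:R `^ y.
    by rewrite powRD//; apply/implyP => _; rewrite gt_eqF.
  (* The lower levels add up to k - i, and -(k - i)/2 = -alpha k + i/2 + k (alpha - 1/2). The last
     part cancels against the volume. *)
  have -> : b%:R `^ (- (\sum_j lo j)%:R / 2) =
    b%:R `^ (- (alpha * k%:R)) * b%:R `^ (i%:R / 2) * b%:R `^ (k%:R * (alpha - 2^-1)) :> R.
    by rewrite -!bD; congr (_ `^ _); rewrite -sumk natrD; field.
  rewrite mulNr [b%:R `^ (- (k%:R * _))]powRN.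
  have : b%:R `^ (k%:R * (alpha - 2^-1)) != 0 :> R by rewrite gt_eqF// powR_gt0.
  by move=> h; field.
apply: ler_wpM2l; first by rewrite !mulr_ge0 ?powR_ge0.
by apply: ler_weXn2l => //; have := ltn_ord i; lia.
Qed.

Lemma net_estimate (V : finType) (A : V -> digit_array b K n) (v0 : V) :
  equidistributed R A k ->
  `|mixed_diff (level_average A) (fun=> 0%N) (fun=> K)|
  <= 'C(k + n.-1, n.-1)%:R * net_bound.
Proof.
move=> eqA; apply: telescoping_bound => //.
  suff H L : (\sum_i L i <= k)%N ->
      level_average A L = avg (fun a : digit_array b K n => g (digit_point R jl a)).
    by move=> L L' ? ?; rewrite !H.
  move=> Lk; rewrite /level_average (eqA L (fun a : digit_array b K n => avg (fun z => g (digit_vertex R jl L a z))))//.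
    exact: (avg_mix _ [ffun=> 0] (fun a : digit_array b K n => g (digit_point R jl a))).
  move=> a z; apply: eq_avg => z'; rewrite /digit_vertex; congr (g (digit_point _ _ _)).
  by apply/ffunP => p; rewrite !ffunE; case: (p \in _).
move=> i lo hi small hiK big sumk.
pose side (j : 'I_n) : R := if (j < i)%N then (b%:R - 1) * b%:R ^- hi j else b%:R ^- lo j.
(* With k < K this keeps every level within the depth of the grid. *)
have lok j : (lo j + (j < i) <= k)%N.
  rewrite -sumk (bigD1 j)//= -addnA leq_add2l; case: ltnP => [ji|]; last by rewrite leq0n.
  by apply: (@leq_trans i); [exact: leq_trans ji|rewrite leq_addl].
have lo_hi j : (lo j <= hi j)%N.
  have [ji|ij|/val_inj ji] := ltngtP j i; first by rewrite small.
    by have [-> _] := big j ij.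
  by rewrite ji hiK; have := lok i; rewrite ltnn; lia.
have hi_K j : (hi j <= K)%N.
  have [ji|ij|/val_inj ji] := ltngtP j i.
  - by rewrite small//; have := lok j; rewrite ji; lia.
  - by have [_ ->] := big j ij.
  - by rewrite ji hiK.
have sideP j : side j = b%:R ^- lo j \/ (hi j = (lo j).+1 /\ side j = (b%:R - 1) * b%:R ^- hi j).
  by rewrite /side; case: ifP => ji; [right; rewrite small|left].
apply: le_trans (@step_bound i lo hi side _ small big sumk) => //.
rewrite /level_average mixed_diff_avg.
under eq_avg => v do rewrite mixed_diff_avg.
rewrite avg_exchange; apply: (le_trans (ler_norm_avg _)).
set B := (X in _ <= X).
rewrite -[B](avg_cst ([ffun=> 0] : digit_array b K n)).
apply: ler_avg => z.
apply: (level_diff_avg_le b_prime alpha_gt gamma_ge0 variation_le _ _ _ _ eqA) => //.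
by rewrite -sumk leq_addr.
Qed.

End net_estimate.

(** * Lebesgue measure and Riemann sums *)

Section tuple_boxes.
Context (R : realType).

Definition tuple_set n (A : set 'rV[R]_n) : set (n.-tuple (measurableTypeR R)) :=
  [set y | A (rV_of_tuple y)].

Lemma tuple_set_box n (I : 'rV[R]_n * 'rV[R]_n) :
  tuple_set (box I) = [set y | forall i, I.1 0 i <= tnth y i < I.2 0 i].
Proof. by apply/seteqP; split => y H i; have := H i; rewrite mxE. Qed.

Lemma measurable_tuple_box n (I : 'rV[R]_n * 'rV[R]_n) :
  measurable (tuple_set (box I)).
Proof.
rewrite tuple_set_box (_ : mkset _ = \bigcap_(i in [set: 'I_n])
   ((fun y : n.-tuple (measurableTypeR R) => tnth y i) @^-1` `[I.1 0 i, I.2 0 i[%classic)); last first.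
  apply/seteqP; split => y H i => [_|]; first by rewrite /= in_itv /= H.
  by have := H i Logic.I; rewrite /= in_itv.
apply: fin_bigcap_measurable => [|i _]; first exact: finite_finset.
rewrite -[X in measurable X]setTI; apply: measurable_tnth => //.
Qed.

Lemma lebesgue_tuple_box n (I : 'rV[R]_n * 'rV[R]_n) :
  (forall i, I.1 0 i <= I.2 0 i) ->
  lebesgue_tuple (tuple_set (box I)) = (box_volume I)%:E.
Proof.
rewrite tuple_set_box /box_volume.
elim: n I => [|n IH] I le12.
  by rewrite big_ord0 /= diracE mem_set// => -[].
pose I' := (\row_i I.1 0 (lift ord0 i), \row_i I.2 0 (lift ord0 i)).
rewrite /= /pushforward.
rewrite (_ : _ @^-1` _ = `[I.1 0 ord0, I.2 0 ord0[%classic `*`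
    [set y : n.-tuple (measurableTypeR R) | forall i, I'.1 0 i <= tnth y i < I'.2 0 i]); last first.
  apply/seteqP; split => [[x y] /= H|[x y] /= [H0 H] i].
    rewrite in_itv /=; split; first by have := H ord0; rewrite (tnth_nth 0).
    move=> i; have := H (lift ord0 i); rewrite !mxE tnthS //.
  rewrite in_itv /= in H0.
  have [j ->|->] := unliftP ord0 i; last by rewrite (tnth_nth 0).
  by rewrite tnthS; have := H j; rewrite !mxE.
rewrite product_measure1E//; last by rewrite -tuple_set_box; exact: measurable_tuple_box.
rewrite [X in (_ * X)%E](IH I') => [|i]; last by rewrite !mxE.
rewrite [X in (X * _)%E](lebesgue_measure_itv `[I.1 0 ord0, I.2 0 ord0[) /= lte_fin big_ord_recl EFinM.
have -> : \prod_(i < n) (I'.2 0 i - I'.1 0 i) =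
   \prod_(i < n) (I.2 0 (lift ord0 i) - I.1 0 (lift ord0 i)).
  by apply: eq_bigr => i _; rewrite !mxE.
by case: ltgtP (le12 ord0) => // ->; rewrite subrr mul0e.
Qed.

End tuple_boxes.

Lemma rV_ball (R : realType) n (x y : 'rV[R]_n) (e : R) :
  ball x e y <-> 0 < e /\ forall i, `|x 0 i - y 0 i| < e.
Proof.
split=> [[e0 H]|[e0 H]]; split => // i; first exact: (H 0 i).
by move=> j; rewrite (ord1 i); exact: H.
Qed.

(** The sigma-algebra lives on tuples and the topology on row vectors. The function is the pointwise
    limit of its values at the lower corners of dyadic cells, and these step functions take
    countably many values on measurable cells. *)
Lemma measurable_continuous_tuple (R : realType) n (g : 'rV[R]_n -> R) :
  continuous g ->
  measurable_fun [set: n.-tuple (measurableTypeR R)] (fun y => g (rV_of_tuple y)).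
Proof.
move=> cg.
pose fl K (y : n.-tuple (measurableTypeR R)) : 'rV[int]_n :=
  \row_i Num.floor ((tnth y i : R) * 2 ^+ K).
pose pt K (c : 'rV[int]_n) : 'rV[R]_n := \row_i ((c 0 i)%:~R / 2 ^+ K).
have K0 K : 0 < 2 ^+ K :> R by exact: exprn_gt0.
apply: (@measurable_fun_cvg _ _ _ _ (fun K y => g (pt K (fl K y)))) => [K|y _].
  move=> _ B mB; rewrite setTI.
  rewrite (_ : _ @^-1` _ = \bigcup_(c in [set c | B (g (pt K c))])
     tuple_set (box (pt K c, pt K (c + const_mx 1)))); last first.
    have mem y c : tuple_set (box (pt K c, pt K (c + const_mx 1))) y <-> fl K y = c.
      split=> [H|<-].
        apply/rowP => i; rewrite mxE; apply: floor_def.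
        by have := H i; rewrite !mxE ler_pdivrMr// ltr_pdivlMr.
      move=> i; rewrite !mxE ler_pdivrMr// ltr_pdivlMr//.
      exact: floor_itv.
    apply/seteqP; split => y /= => [By|[c Bc /mem -> //]].
    by exists (fl K y) => //; exact/mem.
  rewrite bigcup_mkcond; apply: countable_bigcupT_measurable; first exact: countableP.
  by move=> c; case: ifP => // _; exact: measurable_tuple_box.
apply: (continuous_cvg _ (cg _)); apply/cvg_ballP => e e0.
have near2 : \forall K \near \oo, 2 ^- K < e.
  have : (fun K => (2^-1 : R) ^+ K) @ \oo --> 0.
    by apply: cvg_expr; rewrite ger0_norm ?invr_ge0// invf_lt1// ltr1n.
  move=> /cvgr_lt/(_ e e0); apply: filterS => K; by rewrite exprVn.
near=> K; apply/rV_ball; split => // i.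
rewrite !mxE; set v := tnth y i; have /andP[l u] := floor_itv (v * 2 ^+ K).
have l' : (Num.floor (v * 2 ^+ K))%:~R / 2 ^+ K <= v by rewrite ler_pdivrMr.
have u' : v < (Num.floor (v * 2 ^+ K))%:~R / 2 ^+ K + 2 ^- K.
  by rewrite -[X in _ + X]mul1r -mulrDl ltr_pdivlMr//; move: u; rewrite intrD.
rewrite ger0_norm ?subr_ge0//.
have : 2 ^- K < e by near: K.
by move: u' => /[swap]; rewrite ltrBlDl => h1 h2; apply: (lt_trans h2); rewrite ltrD2l.
Unshelve. all: by end_near.
Qed.

(** Heine-Cantor by near-covering compactness of the closed box: the filter is that of radii tending
    to 0 from the right, and the usual halving of radii works near each point. Only [x] is confined
    to the box. *)
Lemma uniform_continuity_box (R : realType) n (lo up : 'rV[R]_n) (f : 'rV[R]_n -> R)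
    (e : R) : continuous f -> 0 < e ->
  exists2 d, 0 < d & forall x y : 'rV[R]_n, (forall i, lo 0 i <= x 0 i <= up 0 i) ->
    (forall i, `|x 0 i - y 0 i| < d) -> `|f x - f y| < e.
Proof.
move=> cf e0.
have cK : compact [set v : 'rV[R]_n | forall i, `[lo 0 i, up 0 i]%classic (v ord0 i)].
  by apply: (@rV_compact R n (fun i => `[lo 0 i, up 0 i]%classic)) => i; exact: segment_compact.
have /compact_near_coveringP cov := cK.
have := cov R (0^'+)
  (fun d x => forall y : 'rV[R]_n, (forall i, `|x 0 i - y 0 i| < d) -> `|f x - f y| < e).
move=> /(_ _)[].
  move=> x _; have e2 : 0 < e / 2 by rewrite divr_gt0.
  have /cvgr_dist_lt/(_ _ e2) := cf x.
  rewrite near_nbhs => /nbhs_ballP[eta /= eta0 H].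
  exists (ball x (eta / 2), [set d | d < eta / 2]).
    split; first by apply: nbhsx_ballx; rewrite divr_gt0.
    by apply: nbhs_right_lt; rewrite divr_gt0.
  move=> [x' d] [/= /rV_ball[_ xx'] de] y x'y.
  have H1 : `|f x - f x'| < e / 2.
    apply: H; apply/rV_ball; split => // i; apply: (lt_le_trans (xx' i)).
    by rewrite ler_pdivrMr// mulr_natr mulr2n lerDl ltW.
  have H2 : `|f x - f y| < e / 2.
    apply: H; apply/rV_ball; split => // i.
    rewrite -[x 0 i](subrK (x' 0 i)) -addrA.
    apply: (le_lt_trans (ler_normD _ _)); rewrite [eta]splitr ltrD//.
    exact: lt_trans (x'y i) de.
  rewrite -[f x'](subrK (f x)) -addrA.
  apply: (le_lt_trans (ler_normD _ _)); rewrite [e]splitr ltrD// distrC //.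
move=> d /= d0 H.
exists (d / 2); first by rewrite divr_gt0.
move=> x y xlu xy; apply: (H (d / 2)) => //=.
- by rewrite sub0r normrN gtr0_norm ?divr_gt0// gtr_pMr// invf_lt1// ltr1n.
- by rewrite divr_gt0.
Qed.

Section digit_cells.
Context (R : realType) (b n K : nat) (jl : 'rV[int]_n * 'rV[int]_n).
Hypothesis b_prime : prime b.

Let b_gt1 : (1 < b)%N := prime_gt1 b_prime.
Let b_gt0R : 0 < b%:R :> R. Proof. by rewrite ltr0n prime_gt0. Qed.

Lemma digit_value_inj (a a' : digit_array b K n) : digit_value a =1 digit_value a' -> a = a'.
Proof.
move=> E; apply/ffunP => -[i r]; apply/val_inj; rewrite /= -!digit_ord.
by apply: (horner_value_inj _ _ (E i)) => // r'; exact: digit_lt.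
Qed.

Lemma digit_value_lt (a : digit_array b K n) i : (digit_value a i < b ^ K)%N.
Proof. by apply: horner_value_lt => r; exact: digit_lt. Qed.

(** An injection between two finite types with b^(nK) elements is a bijection. *)
Lemma digit_value_surj (c : 'I_n -> nat) : (forall i, c i < b ^ K)%N ->
  exists a : digit_array b K n, digit_value a =1 c.
Proof.
move=> cK.
pose F (a : digit_array b K n) : {ffun 'I_n -> 'I_(b ^ K)} :=
  [ffun i => Ordinal (digit_value_lt a i)].
have Finj : injective F.
  move=> a a' /ffunP E; apply: digit_value_inj => i.
  by have := E i; rewrite !ffunE => -[].
have [] := inj_card_bij Finj.
  by rewrite !card_ffun !card_ord card_prod !card_ord Fp_cast// mulnC expnM.
move=> G GK FK; exists (G [ffun i => Ordinal (cK i)]) => i.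
by have /ffunP/(_ i) := FK [ffun i => Ordinal (cK i)]; rewrite !ffunE => -[].
Qed.

Lemma digit_point_in (a : digit_array b K n) : elem_box b jl (digit_point R jl a).
Proof.
rewrite (elem_box_grid R jl K b_gt1); apply/(mem_grid_box jl K b_gt1) => i.
by rewrite grid_floor_point// ltz_nat digit_value_lt.
Qed.

Definition elem_volume : R := \prod_i b%:R ^ jl.1 0 i.

Lemma elem_volume_gt0 : 0 < elem_volume.
Proof. by apply: prodr_gt0 => i _; exact: exprz_gt0. Qed.

Definition digit_cell (a : digit_array b K n) :=
  grid_box R b jl K (digit_value a) (fun i => (digit_value a i).+1).

Lemma mem_digit_cell (a : digit_array b K n) x :
  box (digit_cell a) x <-> forall i, grid_floor b jl K x i = (digit_value a i)%:Z.
Proof.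
rewrite (mem_grid_box jl K b_gt1); split => H i; have := H i; last by move=> ->; lia.
by lia.
Qed.

Lemma elem_box_digit_cells :
  elem_box b jl = \bigcup_(a in [set: digit_array b K n]) box (R := R) (digit_cell a).
Proof.
apply/seteqP; split => [x Jx|x [a _] /mem_digit_cell xa].
  have [c cK E] := mem_elem_box_grid K b_gt1 Jx.
  have [a ac] := digit_value_surj cK.
  by exists a => //; apply/mem_digit_cell => i; rewrite E ac.
rewrite (elem_box_grid R jl K b_gt1); apply/(mem_grid_box jl K b_gt1) => i.
by rewrite xa ltz_nat digit_value_lt.
Qed.

Lemma trivIset_digit_cells (D : set (digit_array b K n)) :
  trivIset D (fun a => box (R := R) (digit_cell a)).
Proof.
move=> a a' _ _ [x [/mem_digit_cell E /mem_digit_cell E']].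
by apply: digit_value_inj => i; have := E i; rewrite E' => -[].
Qed.

Lemma digit_cell_volume (a : digit_array b K n) :
  box_volume (digit_cell a) = elem_volume / #|{: digit_array b K n}|%:R.
Proof.
rewrite grid_box_volume /elem_volume.
rewrite card_ffun card_prod !card_ord Fp_cast//.
under eq_bigr => i _ do rewrite -natrB// subSnn mulr1.
by rewrite big_split /= prodr_const card_ord natrX mulnC exprM exprVn.
Qed.

Lemma digit_cell_dist (a : digit_array b K n) x i : box (digit_cell a) x ->
  `|x 0 i - digit_point R jl a 0 i| <= b%:R ^ jl.1 0 i / b%:R ^+ K.
Proof.
move=> /(_ i); rewrite /= !mxE => /andP[l u]; rewrite ger0_norm ?subr_ge0//.
rewrite lerBlDl; apply: le_trans (ltW u) _; rewrite le_eqVlt; apply/orP; left.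
by apply/eqP; rewrite -natr1; ring.
Qed.

(** The mesh condition is not strict, since the distance of a net point to its truncation is
    estimated by a full mesh width. *)
Definition oscillation_le (g : 'rV[R]_n -> R) (e : R) :=
  forall x y, elem_box b jl x -> elem_box b jl y ->
    (forall i, `|x 0 i - y 0 i| <= b%:R ^ jl.1 0 i / b%:R ^+ K) -> `|g x - g y| <= e.

(** All cells have the same volume, and on each of them [g] is within [e] of its value at the lower
    corner. The real [r] also records that the integral is finite. *)
Lemma riemann_sum (g : 'rV[R]_n -> R) (e : R) : continuous g -> oscillation_le g e ->
  exists2 r, integral_rV (elem_box b jl) g = r%:E &
    `|r - elem_volume * avg (fun a : digit_array b K n => g (digit_point R jl a))| <=
    e * elem_volume.
Proof.
move=> cg og.
pose mu := [the {measure set (n.-tuple (measurableTypeR R)) -> \bar R} of @lebesgue_tuple R n].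
pose G (y : n.-tuple (measurableTypeR R)) := g (rV_of_tuple y).
pose C a := tuple_set (box (digit_cell a)).
set v := elem_volume / #|{: digit_array b K n}|%:R.
have v0 : 0 <= v by rewrite divr_ge0// ltW// elem_volume_gt0.
have muC a : mu (C a) = v%:E.
  rewrite /mu /C /= lebesgue_tuple_box ?digit_cell_volume// => i.
  rewrite !mxE ler_pM2l ?exprz_gt0// lerD2l ler_pM2r ?invr_gt0 ?exprn_gt0//.
  by rewrite ler_nat.
have mC a : measurable (C a) by exact: measurable_tuple_box.
have mG : measurable_fun setT G by exact: measurable_continuous_tuple.
have JC : tuple_set (elem_box b jl) = \big[setU/set0]_(a <- index_enum (digit_array b K n)) C a.
  rewrite -bigcup_seq /tuple_set elem_box_digit_cells.
  apply/seteqP; split=> y [a _ ay]; exists a => //=.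
  exact: mem_index_enum.
have GC a y : C a y -> g (digit_point R jl a) - e <= G y <= g (digit_point R jl a) + e.
  move=> Cy; rewrite -ler_distl; apply: og; [|exact: digit_point_in|].
    by rewrite elem_box_digit_cells; exists a.
  by move=> i; exact: digit_cell_dist.
have intC a : exists2 r, (\int[mu]_(y in C a) (G y)%:E)%E = r%:E &
    `|r - v * g (digit_point R jl a)| <= e * v.
  have iG : mu.-integrable (C a) (EFin \o G).
    apply: measurable_bounded_integrable => //.
    - by rewrite muC ltry.
    - exact: measurable_funS mG.
    - exists (`|g (digit_point R jl a) - e| + `|g (digit_point R jl a) + e|).
      split=> // M MM y Cy; apply/ltW/(le_lt_trans _ MM).
      have /andP[l u] := GC _ _ Cy; rewrite ler_norml; apply/andP; split.
        apply: le_trans l; rewrite lerNl; apply: (le_trans (ler_norm _)).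
        by rewrite normrN lerDl.
      by apply: (le_trans u); apply: (le_trans (ler_norm _)); rewrite lerDr.
  have ic r : mu.-integrable (C a) (EFin \o cst r).
    apply: measurable_bounded_integrable => //; first by rewrite muC ltry.
    by exists `|r|; split => // M MM y _; exact: ltW.
  have Icst r : (\int[mu]_(y in C a) (cst r y)%:E = (r * v)%:E)%E.
    by rewrite (integral_cst mu (mC a) r%:E) muC.
  have Il : (((g (digit_point R jl a) - e) * v)%:E <= \int[mu]_(y in C a) (G y)%:E)%E.
    rewrite -Icst; apply: le_integral; [exact: mC|exact: ic|exact: iG|] => y; rewrite inE => Cy.
    by rewrite lee_fin; have /andP[] := GC _ _ Cy.
  have Iu : (\int[mu]_(y in C a) (G y)%:E <= ((g (digit_point R jl a) + e) * v)%:E)%E.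
    rewrite -Icst; apply: le_integral; [exact: mC|exact: iG|exact: ic|] => y; rewrite inE => Cy.
    by rewrite lee_fin; have /andP[] := GC _ _ Cy.
  case: (\int[mu]_(y in C a) _)%E Il Iu => [r||]//.
  rewrite !lee_fin => Il Iu; exists r => //; rewrite ler_distl.
  by rewrite mulrBl in Il; rewrite mulrDl in Iu; rewrite ![v * _]mulrC Il Iu.
have [r rE rb] : exists2 r : digit_array b K n -> R,
    (forall a, \int[mu]_(y in C a) (G y)%:E = (r a)%:E)%E &
    (forall a, `|r a - v * g (digit_point R jl a)| <= e * v).
  have /choice[r Hr] : forall a, exists r, (\int[mu]_(y in C a) (G y)%:E = r%:E)%E /\
      `|r - v * g (digit_point R jl a)| <= e * v.
    by move=> a; have [r ? ?] := intC a; exists r.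
  by exists r => a; case: (Hr a).
exists (\sum_a r a).
  transitivity (\int[mu]_(y in tuple_set (elem_box b jl)) (G y)%:E)%E; first by [].
  rewrite JC integral_bigsetU_EFin.
  - by rewrite -sumEFin; apply: eq_bigr => a _.
  - by [].
  - exact: index_enum_uniq.
  - move=> a a' _ _ [y [Ca Ca']]; apply: (@trivIset_digit_cells setT) => //.
    by exists (rV_of_tuple y).
  - by apply/measurable_EFinP; exact: measurable_funS mG.
rewrite (_ : _ * avg _ = \sum_(a : digit_array b K n) v * g (digit_point R jl a)); last first.
  by rewrite -mulr_sumr /avg /v; ring.
rewrite -sumrB.
apply: (le_trans (ler_norm_sum _ _ _)).
apply: (@le_trans _ _ (\sum_(a : digit_array b K n) e * v)).
  by apply: ler_sum => a _.
rewrite (eq_bigl (mem {: digit_array b K n}))// sumr_const -[_ *+ _]mulr_natr -mulrA.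
rewrite /v divfK// pnatr_eq0 -lt0n card_ffun card_ord Fp_cast//.
by rewrite expn_gt0 prime_gt0.
Qed.

End digit_cells.

Lemma oscillation_small (R : realType) (b n : nat) (jl : 'rV[int]_n * 'rV[int]_n)
    (g : 'rV[R]_n -> R) (e : R) : (1 < b)%N -> continuous g -> 0 < e ->
  exists K0, forall K, (K0 <= K)%N -> oscillation_le b K jl g e.
Proof.
move=> b1 cg e0.
have b0 : 0 < b%:R :> R by rewrite ltr0n ltnW.
have [d d0 H] := uniform_continuity_box (\row_i (b%:R ^ jl.1 0 i * (jl.2 0 i)%:~R))
  (\row_i (b%:R ^ jl.1 0 i * (jl.2 0 i + 1)%:~R)) cg e0.
pose M : R := \sum_i b%:R ^ jl.1 0 i.
have M0 : 0 <= M by apply: sumr_ge0 => i _; exact: exprz_ge0.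
have Mi i : b%:R ^ jl.1 0 i <= M.
  by rewrite /M (bigD1 i)//= lerDl sumr_ge0// => k _; exact: exprz_ge0.
exists (Num.bound (M / d)) => K KK x y Jx Jy xy.
apply/ltW/H => i; first by have /andP[-> /ltW ->] := Jx i.
apply: (le_lt_trans (xy i)); rewrite ltr_pdivrMr ?exprn_gt0//.
apply: (le_lt_trans (Mi i)); rewrite mulrC -ltr_pdivrMr//.
have : M / d < (Num.bound (M / d))%:R by rewrite archi_boundP// divr_ge0// ltW.
move=> /lt_le_trans; apply; rewrite -natrX ler_nat.
by apply: (leq_trans KK); rewrite ltnW// ltn_expl.
Qed.

(** * Marginals *)

Lemma mixed_diff_dist (R : realFieldType) (Y : Type) n (Phi Psi : ('I_n -> Y) -> R)
    (lo hi : 'I_n -> Y) (c : R) : (forall L, `|Phi L - Psi L| <= c) ->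
  `|mixed_diff Phi lo hi - mixed_diff Psi lo hi| <= 2 ^+ n * c.
Proof.
move=> H; rewrite /mixed_diff -sumrB; apply: (le_trans (ler_norm_sum _ _ _)).
apply: (@le_trans _ _ (\sum_(v : {set 'I_n}) c)).
  by apply: ler_sum => v _; rewrite -mulrBr normrM normrX normrN1 expr1n mul1r.
rewrite (eq_bigl (mem (powerset [set: 'I_n]%SET))) => [|v]; last first.
  by rewrite /= powersetE finset.subsetT.
by rewrite sumr_const card_powerset cardsT card_ord -[_ *+ _]mulr_natl natrX.
Qed.

Section extension.
Context (R : realType) (s : nat) (u : {set 'I_s}).

Lemma enum_val_ex i : i \in u -> exists k : 'I_#|u|, i = enum_val k.
Proof. by move=> iu; exists (enum_rank_in iu i); rewrite enum_rankK_in. Qed.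

Lemma extend_rV_in (x : 'rV[R]_#|u|) k : extend_rV x 0 (enum_val k) = x 0 k.
Proof.
rewrite /extend_rV summxE (bigD1 k)//= !mxE !eqxx mulr1 big1 ?addr0// => l lk.
by rewrite !mxE /= (inj_eq enum_val_inj) eq_sym (negbTE lk) mulr0.
Qed.

Lemma extend_rV_notin (x : 'rV[R]_#|u|) i : i \notin u -> extend_rV x 0 i = 0.
Proof.
move=> iu; rewrite /extend_rV summxE big1// => l _.
rewrite !mxE /=; case: eqP => [E|_]; last by rewrite mulr0.
by move: iu; rewrite E enum_valP.
Qed.

End extension.

Section join_coordinates.
Context (R : realType) (b s : nat) (u : {set 'I_s}) (jl : 'rV[int]_s * 'rV[int]_s).

Definition join_rV (x : 'rV[R]_#|u|) (y : 'rV[R]_#|~: u|) : 'rV[R]_s :=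
  extend_rV x + extend_rV y.

Lemma join_rV_in x y k : join_rV x y 0 (enum_val k) = x 0 k.
Proof.
by rewrite mxE extend_rV_in extend_rV_notin ?addr0// inE negbK enum_valP.
Qed.

Lemma join_rV_notin x y k : join_rV x y 0 (enum_val k) = y 0 k.
Proof.
by rewrite mxE extend_rV_in extend_rV_notin ?add0r//; have := enum_valP k; rewrite inE.
Qed.

Lemma join_rVP (i : 'I_s) : (exists k : 'I_#|u|, i = enum_val k) \/
  (exists k : 'I_#|~: u|, i = enum_val k).
Proof.
have [iu|iu] := boolP (i \in u); first by left; exact: enum_val_ex.
by right; apply: enum_val_ex; rewrite inE.
Qed.

Lemma join_elem_box x y : elem_box b (restrict_pair u jl) x ->
  elem_box b (restrict_pair (~: u)%SET jl) y -> elem_box b jl (join_rV x y).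
Proof.
move=> Jx Jy i; have [[k ->]|[k ->]] := join_rVP i.
  by rewrite join_rV_in; have := Jx k; rewrite !mxE.
by rewrite join_rV_notin; have := Jy k; rewrite !mxE.
Qed.

Lemma continuous_join (f : 'rV[R]_s -> R) x : continuous f -> continuous (f \o join_rV x).
Proof.
move=> cf y; apply: (@continuous_comp _ _ _ (join_rV x) f y); last exact: cf.
apply/(@cvg_ballP _ _ _ _ (nbhs_filter y)) => e e0; apply/nbhs_ballP; exists e => //= y' /rV_ball[_ yy'].
apply/rV_ball; split => // i.
have [[k ->]|[k ->]] := join_rVP i; first by rewrite !join_rV_in subrr normr0.
by rewrite !join_rV_notin.
Qed.

Lemma oscillation_join K (f : 'rV[R]_s -> R) x e :
  elem_box b (restrict_pair u jl) x -> 0 < (b%:R : R) -> oscillation_le b K jl f e ->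
  oscillation_le b K (restrict_pair (~: u)%SET jl) (f \o join_rV x) e.
Proof.
move=> Jx b0 of_ y y' Jy Jy' yy'; apply: of_; [exact: join_elem_box..|].
move=> i; have [[k ->]|[k ->]] := join_rVP i.
  by rewrite !join_rV_in subrr normr0 divr_ge0 ?exprn_ge0 ?exprz_ge0// ltW.
by rewrite !join_rV_notin; have := yy' k; rewrite !mxE.
Qed.

Lemma elem_volume_split : elem_volume R b jl =
  elem_volume R b (restrict_pair u jl) * elem_volume R b (restrict_pair (~: u)%SET jl).
Proof.
rewrite /elem_volume (bigID (mem u)) /=; congr (_ * _).
  by rewrite big_enum_val; apply: eq_bigr => k _; rewrite !mxE.
rewrite (eq_bigl (mem (~: u)%SET)) => [|i]; last by rewrite !inE.
by rewrite big_enum_val; apply: eq_bigr => k _; rewrite !mxE.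
Qed.

End join_coordinates.

Section digit_restriction.
Context (R : realType) (b s K : nat) (u : {set 'I_s}) (jl : 'rV[int]_s * 'rV[int]_s).

Definition restrict_digits (a : digit_array b K s) : digit_array b K #|u| :=
  [ffun p => a (enum_val p.1, p.2)].

Lemma digit_restrict a k r : digit (restrict_digits a) k r = digit a (enum_val k) r.
Proof. by rewrite /digit; case: insub => // r'; rewrite ffunE. Qed.

Lemma restrict_digit_point a i :
  digit_point R (restrict_pair u jl) (restrict_digits a) 0 i =
  digit_point R jl a 0 (enum_val i).
Proof.
rewrite !mxE; congr (_ * (_ + _%:R / _)); apply: eq_horner_value => r _.
exact: digit_restrict.
Qed.

Lemma avg_restrict_digits (h : digit_array b K #|u| -> R) :
  avg (fun z => h (restrict_digits z)) = avg h.
Proof.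
apply: (avg_restrict (i := fun p : 'I_#|u| * 'I_K => (enum_val p.1, p.2)) [ffun=> 0]).
by move=> [k r] [k' r'] [/enum_val_inj -> ->].
Qed.

Definition extend_level (L : 'I_#|u| -> nat) (i : 'I_s) : nat :=
  if [pick k | enum_val k == i] is Some k then L k else 0%N.

Lemma extend_level_in L k : extend_level L (enum_val k) = L k.
Proof.
rewrite /extend_level; case: pickP => [l /eqP/enum_val_inj -> //|/(_ k)].
by rewrite eqxx.
Qed.

Lemma extend_level_notin L i : i \notin u -> extend_level L i = 0%N.
Proof.
move=> iu; rewrite /extend_level; case: pickP => // k /eqP ki.
by move: iu; rewrite -ki enum_valP.
Qed.

Lemma sum_extend_level L : (\sum_i extend_level L i = \sum_k L k)%N.
Proof.
rewrite (bigID (mem u)) /= [X in (_ + X)%N]big1 ?addn0 => [|i]; last exact: extend_level_notin.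
by rewrite big_enum_val; apply: eq_bigr => k _; rewrite extend_level_in.
Qed.

Lemma restrict_digits_mix L a z :
  restrict_digits (mix (prefix_set K (extend_level L)) a z) =
  mix (prefix_set K L) (restrict_digits a) (restrict_digits z).
Proof. by apply/ffunP => -[k r]; rewrite !ffunE !inE /= extend_level_in. Qed.

(** Extending the levels by 0 outside [u] changes neither their sum nor the digits involved, so a
    projection inherits [k]. *)
Lemma equidistributed_restrict (V : finType) (A : V -> digit_array b K s) k :
  equidistributed R A k -> equidistributed R (fun v => restrict_digits (A v)) k.
Proof.
move=> eA L h Lk hL.
rewrite (eA (extend_level L) (fun a => h (restrict_digits a))).
- exact: avg_restrict_digits.
- by rewrite sum_extend_level.
- by move=> a z; rewrite restrict_digits_mix hL.
Qed.

End digit_restriction.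

Section marginal_estimate.
Context (R : realType) (b s K k : nat) (jl : 'rV[int]_s * 'rV[int]_s).
Context (f : 'rV[R]_s -> R) (e : R) (V : finType) (v0 : V) (A : V -> digit_array b K s).
Hypothesis b_prime : prime b.
Hypothesis kK : (k < K)%N.
Hypothesis f_cont : continuous f.
Hypothesis f_osc : oscillation_le b K jl f e.
Hypothesis A_equi : equidistributed R A k.

Let b_gt0R : 0 < b%:R :> R. Proof. by rewrite ltr0n prime_gt0. Qed.

Let fp (a : digit_array b K s) := f (digit_point R jl a).

Definition coordinate_set (u : {set 'I_s}) : {set 'I_s * 'I_K} := [set p | p.1 \in u]%SET.

(** The coordinates in [u] come from the net, the others run over the grid: the empty set gives the
    grid average, the full set the net average. *)
Definition coordinate_average (u : {set 'I_s}) : R :=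
  avg (fun v => avg (fun z => fp (mix (coordinate_set u) (A v) z))).

Section one_set.
Variables (u : {set 'I_s}).

Let jlu := restrict_pair u jl.
Let jlc := restrict_pair (~: u)%SET jl.
Let ru := @restrict_digits b s K u.
Let rc := @restrict_digits b s K (~: u)%SET.
Let volc := elem_volume R b jlc.

Let fiber_average (a : digit_array b K s) : R :=
  avg (fun z => fp (mix (coordinate_set u) a z)).

Let digit_point_mix a z :
  digit_point R jl (mix (coordinate_set u) a z) =
  join_rV (digit_point R jlu (ru a)) (digit_point R jlc (rc z)).
Proof.
have H (w : {set 'I_s}) (i : 'I_#|w|) (a' : digit_array b K s) :
    (forall r, mix (coordinate_set u) a z (enum_val i, r) = a' (enum_val i, r)) ->
    digit_point R jl (mix (coordinate_set u) a z) 0 (enum_val i) =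
    digit_point R jl a' 0 (enum_val i).
  move=> E; rewrite !mxE; congr (_ * (_ + _%:R / _)); apply: eq_horner_value => r _.
  by rewrite /digit; case: insub => // r'; rewrite E.
apply/rowP => i; have [[l ->]|[l ->]] := join_rVP u i.
  rewrite join_rV_in restrict_digit_point; apply: H => r.
  by rewrite ffunE inE /= enum_valP.
rewrite join_rV_notin restrict_digit_point; apply: H => r.
by rewrite ffunE inE /=; have := enum_valP l; rewrite inE => /negbTE ->.
Qed.

(** A Riemann sum along the fibre over a grid point of the coordinates in [u]. It replaces the
    integral that defines the marginal by a grid average. *)
Let marginal_fiber a :
  `|marginal b f jl (digit_point R jlu (ru a)) - volc * fiber_average a| <= e * volc.
Proof.
set x := digit_point R jlu (ru a).
have Jx : elem_box b jlu x by exact: digit_point_in.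
have [r rE rb] := riemann_sum b_prime (@continuous_join _ _ _ f x f_cont)
  (oscillation_join Jx b_gt0R f_osc).
rewrite /marginal (_ : integral_rV _ _ = r%:E)//=.
have -> : fiber_average a = avg (fun w : digit_array b K #|~: u|%SET =>
    (f \o join_rV x) (digit_point R jlc w)) => //.
rewrite -avg_restrict_digits; apply: eq_avg => z.
by rewrite /fp digit_point_mix.
Qed.

Let level_fun (L : 'I_#|u| -> nat) : R :=
  avg (fun v => avg (fun z => fp (mix (prefix_set K (extend_level L)) (A v) z))).

(** Outside [u] the level is 0, so these coordinates already come from the grid array [z]; drawing
    them afresh leaves the average unchanged. *)
Let level_funE L : level_fun L =
  avg (fun v => avg (fun z => fiber_average (mix (prefix_set K (extend_level L)) (A v) z))).
Proof.
apply: eq_avg => v; rewrite -(avg_mix (coordinate_set u) [ffun=> 0]).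
apply: eq_avg => z; apply: eq_avg => z'; congr fp; apply/ffunP => p.
rewrite !ffunE !inE; case: ifP => [pL|//].
suff -> : p.1 \in u by [].
by apply: contraLR pL => /extend_level_notin ->.
Qed.

Let level_average_fun L :
  `|level_average jlu (marginal b f jl) (fun v => ru (A v)) L - volc * level_fun L| <=
  e * volc.
Proof.
rewrite level_funE -avgZ /level_average.
have -> : avg (fun v => avg (fun z => marginal b f jl (digit_vertex R jlu L (ru (A v)) z))) =
  avg (fun v => avg (fun z => marginal b f jl (digit_point R jlu
     (ru (mix (prefix_set K (extend_level L)) (A v) z))))).
  apply: eq_avg => v; rewrite -[LHS]avg_restrict_digits; apply: eq_avg => z.
  by rewrite /digit_vertex /ru restrict_digits_mix.
rewrite -avgB; apply: (le_trans (ler_norm_avg _)).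
rewrite -[leRHS](avg_cst v0); apply: ler_avg => v.
rewrite -avgZ -avgB; apply: (le_trans (ler_norm_avg _)).
rewrite -[leRHS](avg_cst ([ffun=> 0] : digit_array b K s)); apply: ler_avg => z.
exact: marginal_fiber.
Qed.

(** At the vertex attached to [v], the coordinates in u \ v have level [K], hence come from the net,
    and the others have level 0. The proof matches the subsets of ['I_#|u|] with those of [u]. *)
Let level_diff_sum : mixed_diff level_fun (fun=> 0%N) (fun=> K) =
  \sum_(v : {set 'I_s} | v \subset u) (-1) ^+ #|v| * coordinate_average (u :\: v)%SET.
Proof.
pose im (v : {set 'I_#|u|}) : {set 'I_s} := (enum_val @: v)%SET.
pose pr (w : {set 'I_s}) : {set 'I_#|u|} := [set i | enum_val i \in w]%SET.
rewrite (reindex_onto im pr) /=; last first.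
  move=> w /fintype.subsetP wu; apply/finset.setP => i; apply/imsetP/idP.
    by move=> [l]; rewrite inE => lw ->.
  move=> iw; have [l il] := enum_val_ex (wu i iw).
  by exists l => //; rewrite inE -il.
have imu v : im v \subset u.
  by apply/fintype.subsetP => i /imsetP[l _ ->]; exact: enum_valP.
have inim v l : (enum_val l \in im v) = (l \in v).
  by apply/imsetP/idP => [[l' l'v /enum_val_inj ->]//|lv]; exists l.
rewrite (eq_bigl xpredT) => [|v]; last first.
  by rewrite imu; apply/eqP/finset.setP => l; rewrite inE inim.
apply: eq_bigr => v _; rewrite card_imset; last exact: enum_val_inj.
congr (_ * _); apply: eq_avg => x; apply: eq_avg => z; congr fp.
apply/ffunP => -[i r]; rewrite !ffunE !inE /=; congr (if _ then _ else _).
have [/enum_val_ex[l ->]|iu] := boolP (i \in u).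
  by rewrite extend_level_in inim; case: ifP => //= lv; rewrite ?ltn0 ?ltn_ord.
by rewrite extend_level_notin// andbF.
Qed.

(** [net_estimate] is applied to the marginal; passing from it to grid averages costs [e * volc] at
    each of the 2^|u| vertices. *)
Lemma coordinate_average_bound (alpha gamma : R) : u != finset.set0 ->
  2^-1 < alpha -> 0 <= gamma ->
  (variation_alpha alpha (elem_box b jlu) (marginal b f jl) <= gamma%:E)%E ->
  volc * `|\sum_(v : {set 'I_s} | v \subset u) (-1) ^+ #|v| * coordinate_average (u :\: v)%SET|
  <= 'C(k + #|u|.-1, #|u|.-1)%:R * net_bound b k jlu alpha gamma + 2 ^+ #|u| * (e * volc).
Proof.
move=> u0 a_gt g0 Vg; rewrite -level_diff_sum.
have volc0 : 0 <= volc by apply/ltW/elem_volume_gt0.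
have n0 : (0 < #|u|)%N by rewrite card_gt0.
have N := @net_estimate R b #|u| K k jlu (marginal b f jl) alpha gamma b_prime a_gt g0 Vg
  n0 kK V (fun v => ru (A v)) v0 (equidistributed_restrict A_equi).
have Dst := @mixed_diff_dist R nat #|u|
  (level_average jlu (marginal b f jl) (fun v => ru (A v)))
  (fun L => volc * level_fun L) (fun=> 0%N) (fun=> K) _ level_average_fun.
have ZE : mixed_diff (fun L => volc * level_fun L) (fun=> 0%N) (fun=> K) =
    volc * mixed_diff level_fun (fun=> 0%N) (fun=> K).
  by rewrite /mixed_diff mulr_sumr; apply: eq_bigr => v _; rewrite mulrCA.
rewrite -[X in X * _](ger0_norm volc0) -normrM -ZE.
rewrite -[X in `|X|](subrK (mixed_diff
  (level_average jlu (marginal b f jl) (fun v => ru (A v))) (fun=> 0%N) (fun=> K))).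
rewrite [leRHS]addrC; apply: (le_trans (ler_normD _ _)).
by apply: lerD => //; rewrite distrC.
Qed.

End one_set.

Lemma coordinate_average0 : coordinate_average finset.set0 = avg fp.
Proof.
rewrite /coordinate_average (eq_avg (g := fun=> avg fp)) ?(avg_cst v0)// => v.
by apply: eq_avg => z; congr fp; apply/ffunP => p; rewrite ffunE !inE.
Qed.

Lemma coordinate_averageT : coordinate_average [set: 'I_s]%SET = avg (fun v => fp (A v)).
Proof.
apply: eq_avg => v; rewrite -[RHS](avg_cst ([ffun=> 0] : digit_array b K s)).
by apply: eq_avg => z; congr fp; apply/ffunP => p; rewrite ffunE !inE.
Qed.

Lemma net_error_grid (alpha gamma : {set 'I_s} -> R) :
  (forall u : {set 'I_s}, u != finset.set0 -> [/\ 2^-1 < alpha u, 0 <= gamma u &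
    (variation_alpha (alpha u) (elem_box b (restrict_pair u jl)) (@marginal R b s f u jl)
      <= (gamma u)%:E)%E]) ->
  elem_volume R b jl * `|avg (fun v => fp (A v)) - avg fp| <=
  \sum_(u : {set 'I_s} | u != finset.set0)
    (elem_volume R b (restrict_pair u jl) *
     ('C(k + #|u|.-1, #|u|.-1)%:R * net_bound b k (restrict_pair u jl) (alpha u) (gamma u)) +
     2 ^+ #|u| * (e * elem_volume R b jl)).
Proof.
move=> H.
have vol0 : 0 <= elem_volume R b jl by apply/ltW/elem_volume_gt0.
(* The net average is expanded over the sets [u]. The term of the empty set is the grid average and
   cancels. *)
rewrite -coordinate_average0 -coordinate_averageT -(sum_alternating_subset coordinate_average).
rewrite (bigD1 finset.set0)//= (eq_bigl (pred1 finset.set0)) ?big_pred1_eq; last first.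
  by move=> v; rewrite /= finset.subset0.
rewrite cards0 mul1r finset.setD0 addrAC subrr add0r.
rewrite -[X in X * _](ger0_norm vol0) -normrM mulr_sumr.
apply: (le_trans (ler_norm_sum _ _ _)); apply: ler_sum => u u0.
have [a1 g0 Vg] := H u u0.
rewrite normrM (ger0_norm vol0) {1}(elem_volume_split R b u jl) -mulrA.
have volu : 0 <= elem_volume R b (restrict_pair u jl) by apply/ltW/elem_volume_gt0.
apply: (le_trans (ler_wpM2l volu (coordinate_average_bound u0 a1 g0 Vg))).
by rewrite mulrDr lerD2l (elem_volume_split R b u jl) le_eqVlt; apply/orP; left; apply/eqP; ring.
Qed.

End marginal_estimate.

(** * Digital nets *)

Lemma free_map_subset (F : fieldType) (vT : vectType F) (T : eqType) (g : T -> vT)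
    (X Y : seq T) : uniq X -> uniq Y -> {subset X <= Y} ->
  free [seq g y | y <- Y] -> free [seq g x | x <- X].
Proof.
move=> uX uY XY.
have pY : perm_eq ([seq y <- Y | y \in X] ++ [seq y <- Y | y \notin X]) Y.
  by rewrite (perm_filterC (mem X)).
rewrite -(perm_free (perm_map g pY)) map_cat => /catl_free.
rewrite (perm_free (Y := [seq g x | x <- X]))//; apply: perm_map.
apply: uniq_perm => [||x]; [exact: filter_uniq|exact: uX|].
by rewrite mem_filter; apply: andb_idr => /XY.
Qed.

Lemma digits_inj (b m n n' : nat) : (0 < b)%N -> (n < b ^ m)%N -> (n' < b ^ m)%N ->
  (forall r, (r < m)%N -> n %/ b ^ r = n' %/ b ^ r %[mod b]) -> n = n'.
Proof.
move=> b0; elim: m n n' => [|m IH] n n'.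
  by rewrite !ltnS !leqn0 => /eqP -> /eqP ->.
rewrite expnSr => nb n'b H.
rewrite (divn_eq n b) (divn_eq n' b); congr (_ * _ + _)%N.
  apply: IH; [by rewrite ltn_divLR|by rewrite ltn_divLR|].
  by move=> r rm; rewrite -!divnMA -expnS; apply: H.
by have := H 0%N (ltn0Sn _); rewrite !divn1.
Qed.

Lemma digit_vector_bij (b m : nat) : prime b ->
  bijective (fun n : 'I_(b ^ m) => digit_vector b m n).
Proof.
move=> b_prime; apply: inj_card_bij; last first.
  by rewrite card_mx card_ord Fp_cast// muln1 card_ord.
move=> n n' /matrixP E; apply/val_inj/(digits_inj (prime_gt0 b_prime) (ltn_ord n) (ltn_ord n')).
move=> r rm; have := E (Ordinal rm) 0; rewrite !mxE /= => /(congr1 val) /=.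
by rewrite !val_Fp_nat.
Qed.

Lemma avg_bij (R : realFieldType) (X Y : finType) (g : X -> Y) (h : Y -> R) :
  bijective g -> avg (fun x => h (g x)) = avg h.
Proof.
move=> gb; rewrite /avg (bij_eq_card gb); congr (_ / _).
by rewrite [RHS](reindex g)//; exact: onW_bij.
Qed.

Section net_digits.
Context (R : realType) (b s m K : nat).
Context (C : 'I_s -> nat -> 'rV['F_b]_m) (sigma : 'I_s -> nat -> 'F_b).
Hypothesis b_prime : prime b.

Definition net_digits (n : 'I_(b ^ m)) : digit_array b K s :=
  affine_digits (fun p : 'I_s * 'I_K => C p.1 p.2) (fun p => sigma p.1 p.2)
    (digit_vector b m n).

Lemma net_digits_equidistributed (k : nat) : (0 < s)%N ->
  (forall d : 'I_s -> nat, (\sum_i d i = k)%N ->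
     free [seq C i r | i <- enum 'I_s, r <- iota 0 (d i)]) ->
  equidistributed R net_digits k.
Proof.
move=> s0 fC L h Lk hL.
transitivity (avg (fun v => h (affine_digits (fun p : 'I_s * 'I_K => C p.1 p.2)
    (fun p => sigma p.1 p.2) v))).
  rewrite -[RHS](avg_bij _ (digit_vector_bij m b_prime)); exact: eq_avg.
apply: (@avg_affine_digits _ _ _ _ _ _ (prefix_set K L)) => //.
(* Independence is given only for row counts with sum exactly [k], so the missing rows are added in
   one coordinate. That [d i0] may exceed [K] is harmless: the rows of [C] are indexed by all of
   [nat], and a subfamily of a free family is free. *)
pose i0 := Ordinal s0; pose d i := (L i + if i == i0 then k - \sum_i L i else 0)%N.
have dk : (\sum_i d i = k)%N by rewrite big_split /= -big_mkcond /= big_pred1_eq subnKC.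
pose Cn (p : 'I_s * nat) := C p.1 p.2.
pose em (p : 'I_s * 'I_K) : 'I_s * nat := (p.1, p.2 : nat).
have -> : [seq C p.1 p.2 | p : 'I_s * 'I_K <- enum (prefix_set K L)] =
    map Cn (map em (enum (prefix_set K L))).
  by rewrite -map_comp.
apply: (@free_map_subset _ _ _ _ _ [seq (i, r) | i <- enum 'I_s, r <- iota 0 (d i)]).
- by rewrite map_inj_uniq ?enum_uniq// => -[i r] [i' r'] [-> /val_inj ->].
- apply: allpairs_uniq_dep; [exact: enum_uniq|by move=> *; exact: iota_uniq|].
  by move=> [i r] [i' r'] _ _ /= [-> ->].
- move=> _ /mapP[[i r] + ->]; rewrite mem_enum inE /= => rL.
  apply/allpairsPdep; exists i, (r : nat); split => //; first by rewrite mem_enum.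
  by rewrite mem_iota /= add0n (leq_trans rL)// leq_addr.
- by rewrite map_allpairs; exact: fC.
Qed.

End net_digits.

Lemma base_expansion_truncation (R : realType) (b : nat) (d : nat -> nat) (y : R) K :
  (1 < b)%N -> base_expansion b d y ->
  0 <= y - (horner_value b d K)%:R / b%:R ^+ K <= b%:R ^- K.
Proof.
move=> b1 [db _ cv].
have b0 : 0 < b%:R :> R by rewrite ltr0n ltnW.
pose S n : R := \sum_(r < n) (d r)%:R / b%:R ^+ r.+1.
have SE : series (fun k => (d k)%:R / b%:R ^+ k.+1) = S :> (nat -> R).
  by apply/funext => n; rewrite /series /= big_mkord.
rewrite SE in cv.
rewrite horner_value_series ?(ltnW b1)// -/(S K).
have term0 r : 0 <= (d r)%:R / b%:R ^+ r.+1 :> R by rewrite divr_ge0 ?exprn_ge0// ltW.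
have Sinc : nondecreasing_seq S.
  apply/nondecreasing_seqP => n; rewrite /S big_ord_recr lerDl //.
have cS : cvgn S by apply/cvg_ex; exists y.
have yE : limn S = y by apply/cvg_lim.
rewrite subr_ge0 -yE nondecreasing_cvgn_le//= lerBlDl.
apply: limr_le => //; exists K => // n /= Kn.
rewrite -(subnKC Kn); move: (n - K)%N => e.
(* Digits are at most b - 1, and a tail of such digits telescopes; subtracting b^(-(K+e)) makes the
   bound inductive. *)
suff : S (K + e)%N <= S K + (b%:R ^- K - b%:R ^- (K + e)).
  move=> /le_trans; apply; rewrite lerD2l lerBlDr lerDl invr_ge0 exprn_ge0// ltW//.
elim: e => [|e IH]; first by rewrite addn0 subrr addr0.
rewrite addnS {1}/S big_ord_recr /= -/(S _).
have := db (K + e)%N; set q := (K + e)%N => dq.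
have H : (d q)%:R / b%:R ^+ q.+1 + b%:R ^- q.+1 <= b%:R ^- q :> R.
  have -> : b%:R ^- q = b%:R / b%:R ^+ q.+1 :> R.
    by rewrite exprS invfM mulrA mulfV ?mul1r// gt_eqF.
  rewrite -[X in _ + X]mul1r -mulrDl ler_pM2r ?invr_gt0 ?exprn_gt0//.
  by rewrite natr1 ler_nat.
apply: (le_trans (lerD IH (lexx _))); rewrite -!addrA !lerD2l.
by rewrite addrC lerBlDr addrC lerBrDr.
Qed.

Lemma prodr_exprz (R : fieldType) (I : finType) (P : pred I) (x : R) (j : I -> int) :
  x != 0 -> \prod_(i | P i) x ^ j i = x ^ (\sum_(i | P i) j i).
Proof.
move=> x0; rewrite (big_morph (fun k : int => x ^ k) (id1 := 1) (op1 := *%R))//.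
by move=> ? ?; exact: expfzDr.
Qed.

(** The constant of the theorem has one more factor [net_step], times b^(1/2-alpha). Together they
    are b^(1-alpha) (b-1)^(alpha-1/2), at least 1 for 1/2 < alpha <= 1. The exponent alpha + 1/2 of
    the volume joins alpha - 1/2 from [net_bound] with the full volume in front. *)
Lemma net_bound_le (R : realType) (b s k : nat) (jl : 'rV[int]_s * 'rV[int]_s)
    (u : {set 'I_s}) (alpha gamma : R) :
  prime b -> 2^-1 < alpha <= 1 -> 0 <= gamma -> u != finset.set0 ->
  elem_volume R b (restrict_pair u jl) *
    ('C(k + #|u|.-1, #|u|.-1)%:R * net_bound b k (restrict_pair u jl) alpha gamma) <=
  gamma * net_constant b alpha u jl * b%:R `^ (- (alpha * k%:R)) *
    'C(k + #|u|, #|u|.-1)%:R.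
Proof.
move=> b_prime /andP[a2 a1] g0 u0.
have b0 : 0 < b%:R :> R by rewrite ltr0n prime_gt0.
have b1 : 1 <= b%:R - 1 :> R by rewrite lerBrDr -[1 + 1]/(2%:R) ler_nat prime_gt1.
have bD x y : (b%:R : R) `^ (x + y) = b%:R `^ x * b%:R `^ y.
  by rewrite powRD//; apply/implyP => _; rewrite gt_eqF.
have volE : elem_volume R b (restrict_pair u jl) =
    b%:R `^ (\sum_(i in u) jl.1 0 i)%:~R.
  rewrite powR_intmul ?ltW// -prodr_exprz ?gt_eqF// big_enum_val.
  by apply: eq_bigr => i _; rewrite !mxE.
rewrite /net_bound -/(elem_volume R b (restrict_pair u jl)) volE /net_constant.
set j := (_%:~R); set n := #|u|; set q := b%:R `^ (- (alpha * k%:R)).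
have n0 : (0 < n)%N by rewrite card_gt0.
have stepn : @net_step R b alpha ^+ n.-1 <= (b%:R - 1) `^ ((alpha - 2^-1) * n%:R) *
    b%:R `^ (n%:R / 2) * b%:R `^ (2^-1 - alpha).
  have -> : (b%:R - 1) `^ ((alpha - 2^-1) * n%:R) * b%:R `^ (n%:R / 2) =
      @net_step R b alpha ^+ n :> R.
    rewrite /net_step exprMn -!powR_mulrn ?powR_ge0// -!powRrM mulrC.
    by congr (_ `^ _ * _); rewrite mulrC.
  have s0 : 0 <= @net_step R b alpha by rewrite mulr_ge0 ?powR_ge0.
  rewrite -[in leRHS](prednK n0) exprSr -mulrA ler_peMr ?exprn_ge0//.
  rewrite /net_step mulrAC -bD mulr_ege1//; apply: powR_ge1 => //.
  - by rewrite ler1n prime_gt0.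
  - by rewrite addrA -[2^-1 + 2^-1]mulr2n -[_ *+ 2]mulr_natr mulVf// subr_ge0.
  - by rewrite subr_ge0 ltW.
rewrite (_ : b%:R `^ j * _ = (gamma * b%:R `^ ((alpha + 2^-1) * j) * q) *
    ('C(k + n.-1, n.-1)%:R * @net_step R b alpha ^+ n.-1)); last first.
  have -> : b%:R `^ ((alpha + 2^-1) * j) = b%:R `^ j * (b%:R `^ j) `^ (alpha - 2^-1) :> R.
    by rewrite -powRrM -bD; congr (_ `^ _); field.
  by ring.
set c := _ * b%:R `^ (2^-1 - alpha) in stepn *.
rewrite [leRHS](_ : _ = (gamma * b%:R `^ ((alpha + 2^-1) * j) * q) *
    ('C(k + n, n.-1)%:R * c)); last by ring.
apply: ler_wpM2l; first by rewrite !mulr_ge0 ?powR_ge0.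
apply: ler_pM => //; first by rewrite exprn_ge0// mulr_ge0 ?powR_ge0.
by rewrite ler_nat leq_bin2l// leq_add2l leq_pred.
Qed.

Lemma net_error (R : realType) (b s N t m : nat) (jl : 'rV[int]_s * 'rV[int]_s)
    (x : 'I_N -> 'rV[R]_s) (A : {set 'I_N}) (f : 'rV[R]_s -> R)
    (alpha gamma : {set 'I_s} -> R) (r : R) :
  prime b -> (0 < s)%N -> continuous f -> digital_net_in b t m jl x A ->
  (forall u : {set 'I_s}, u != finset.set0 -> [/\ 2^-1 < alpha u <= 1, 0 <= gamma u &
    (variation_alpha (alpha u) (elem_box b (restrict_pair u jl)) (@marginal R b s f u jl)
      <= (gamma u)%:E)%E]) ->
  integral_rV (elem_box b jl) f = r%:E ->
  `|b%:R ^ (\sum_i jl.1 0 i) / #|A|%:R * (\sum_(n in A) f (x n)) - r| <=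
  \sum_(u : {set 'I_s} | u != finset.set0)
    gamma u * net_constant b (alpha u) u jl * b%:R `^ (- (alpha u * (m - t)%:R)) *
    'C(m - t + #|u|, #|u|.-1)%:R.
Proof.
move=> b_prime s0 cf [h [hinj hA [tm y01 [C [sigma [dig fC]]]]]] Hu fr.
have b0 : 0 < b%:R :> R by rewrite ltr0n prime_gt0.
set k := (m - t)%N; set Vol := elem_volume R b jl.
have Vol0 : 0 < Vol by exact: elem_volume_gt0.
have VolE : b%:R ^ (\sum_i jl.1 0 i) = Vol by rewrite -prodr_exprz ?gt_eqF.
have v0 : 'I_(b ^ m) by apply: (Ordinal (n := b ^ m) (m := 0)); rewrite expn_gt0 prime_gt0.
have avgA : b%:R ^ (\sum_i jl.1 0 i) / #|A|%:R * (\sum_(n in A) f (x n)) =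
    Vol * avg (fun v => f (x (h v))).
  rewrite VolE -hA card_imset// cardsT big_imset /=; last by move=> ? ? _ _ /hinj.
  rewrite /avg (eq_bigl xpredT) => [|v]; last by rewrite inE.
  by ring.
rewrite avgA.
suff H e : 0 < e -> `|Vol * avg (fun v => f (x (h v))) - r| <=
  \sum_(u : {set 'I_s} | u != finset.set0)
    (elem_volume R b (restrict_pair u jl) *
     ('C(k + #|u|.-1, #|u|.-1)%:R * net_bound b k (restrict_pair u jl) (alpha u) (gamma u))) + e.
  apply: (@le_trans _ _ (\sum_(u : {set 'I_s} | u != finset.set0)
    (elem_volume R b (restrict_pair u jl) *
     ('C(k + #|u|.-1, #|u|.-1)%:R * net_bound b k (restrict_pair u jl) (alpha u) (gamma u))))).
    by apply/ler_addgt0Pr => e e0; exact: H.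
  by apply: ler_sum => u u0; have [a g0 _] := Hu u u0; exact: net_bound_le.
(* The 2 pays for truncating the net points and for the Riemann sum of the integral; 2^|u| pays for
   the vertices in the estimate of the part attached to [u]. *)
move=> e0; pose c : R := 2 + \sum_(u : {set 'I_s} | u != finset.set0) 2 ^+ #|u|.
have c0 : 0 < c by rewrite ltr_pwDl// sumr_ge0// => u _; exact: exprn_ge0.
pose d := e / (Vol * c).
have d0 : 0 < d by rewrite divr_gt0// mulr_gt0.
have [K0 HK0] := oscillation_small jl (prime_gt1 b_prime) cf d0.
(* The grid must be fine enough for the oscillation and deeper than the [k] levels of the net. *)
pose K := maxn K0 k.+1; have kK : (k < K)%N by rewrite leq_maxr.
have of_ : oscillation_le b K jl f d by apply: HK0; exact: leq_maxl.
pose X := @net_digits b s m K C sigma.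
have eX : equidistributed R X k by exact: net_digits_equidistributed.
pose fp (a : digit_array b K s) := f (digit_point R jl a).
have bj i : 0 < (b%:R : R) ^ jl.1 0 i by exact: exprz_gt0.
have xE v i : x (h v) 0 i = b%:R ^ jl.1 0 i * ((jl.2 0 i)%:~R + to_unit_cube b jl (x (h v)) 0 i).
  by rewrite mxE addrC subrK -invr_expz mulVKf// gt_eqF.
have fX v : `|f (x (h v)) - fp (X v)| <= d.
  apply: of_; [|exact: digit_point_in|] => i.
    have /andP[y0 y1] := y01 v i; rewrite xE [X in X <= _]mxE [X in _ < X]mxE.
    by rewrite ler_pM2l// ltr_pM2l// lerDl y0 intrD ltrD2l.
  rewrite xE [digit_point _ _ _ _ _]mxE -mulrBr opprD addrACA subrr add0r.
  rewrite normrM (ger0_norm (ltW (bj i))) ler_pM2l//.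
  have := base_expansion_truncation K (prime_gt1 b_prime) (dig v i).
  rewrite (@eq_horner_value _ _ (digit (X v) i)) => [|q qK]; last first.
    by rewrite -[q]/(val (Ordinal qK)) digit_ord ffunE.
  by case/andP => l u; rewrite ger0_norm.
have [r' r'E rb] := riemann_sum b_prime cf of_.
move: r'E; rewrite fr => -[rr']; rewrite -{}rr' in rb.
have NE := @net_error_grid R b s K k jl f d _ v0 X b_prime kK cf of_ eX alpha gamma.
have {}NE := NE (fun u u0 => let: And3 a g0 Vg := Hu u u0 in And3 (proj1 (andP a)) g0 Vg).
rewrite -/Vol -/fp in NE.
have D1 : `|Vol * avg (fun v => f (x (h v))) - Vol * avg (fun v => fp (X v))| <= Vol * d.
  rewrite -mulrBr -avgB normrM gtr0_norm// ler_wpM2l ?(ltW Vol0)//.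
  by apply: (le_trans (ler_norm_avg _)); rewrite -[leRHS](avg_cst v0); exact: ler_avg.
have D2 : `|Vol * avg (fun v => fp (X v)) - Vol * avg fp| = Vol * `|avg (fun v => fp (X v)) - avg fp|.
  by rewrite -mulrBr normrM gtr0_norm.
have D3 : `|Vol * avg fp - r| <= d * Vol by rewrite distrC.
apply: (le_trans (ler_distD (Vol * avg (fun v => fp (X v))) _ _)).
apply: (le_trans (lerD D1 (ler_distD (Vol * avg fp) _ _))); rewrite D2.
apply: (le_trans (lerD (lexx _) (lerD NE D3))).
rewrite big_split /= -mulr_suml [leLHS](_ : _ = \sum_(u : {set 'I_s} | u != finset.set0)
    (elem_volume R b (restrict_pair u jl) *
     ('C(k + #|u|.-1, #|u|.-1)%:R * net_bound b k (restrict_pair u jl) (alpha u) (gamma u)))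
   + d * Vol * c); last by rewrite /c; ring.
by rewrite lerD2l /d -!mulrA [_ * (Vol * c)]mulVf ?mulr1// gt_eqF// mulr_gt0.
Qed.

(** * The worst-case error *)

Lemma poweR_half_le (R : realType) (S : \bar R) (c : R) :
  (0 <= S)%E -> (poweR S 2^-1 <= c%:E)%E -> (S <= (c ^+ 2)%:E)%E.
Proof.
case: S => [S|//|//]; last by rewrite poweRyr// leye_eq.
rewrite lee_fin poweR_EFin !lee_fin => S0 Sc.
rewrite -[S]sqr_sqrtr// -powR12_sqrt//; apply: lerXn2r => //.
  by rewrite nnegrE powR_ge0.
by rewrite nnegrE (le_trans (powR_ge0 _ _) Sc).
Qed.

Lemma sqre_le1 (R : realType) (c : R) (V : \bar R) : 0 < c ->
  ((c^-1%:E * V) ^+ 2 <= 1)%E -> (V <= c%:E)%E.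
Proof.
move=> c0; case: V => [v||]; rewrite ?leNye//.
  rewrite -EFinM -EFin_expe !lee_fin => H.
  have : c^-1 * v <= 1.
    rewrite (le_trans (ler_norm _))// -(@ler_pXn2r _ 2)// ?nnegrE//.
    by rewrite real_normK ?num_real// expr1n.
  by rewrite ler_pdivrMl// mulr1.
by rewrite gt0_muley ?lte_fin ?invr_gt0// expe2 mulyy leye_eq.
Qed.

Section function_in_ball.
Context (R : realType) (b s : nat) (D : set ('rV[int]_s * 'rV[int]_s)).
Context (alpha gamma : {set 'I_s} -> set 'rV[R]_s -> R) (f : 'rV[R]_s -> R).
Hypothesis b_prime : prime b.
Hypothesis gamma_weights : local_weights b D gamma.
Hypothesis f_cont : continuous f.
Hypothesis f_ball : (weighted_variation b D alpha gamma f <= 1)%E.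

Let J jl : set 'rV[R]_s := elem_box b jl.

Let gamma_gt0 u jl : D jl -> 0 < gamma u (J jl).
Proof. by move=> Djl; have [H _] := gamma_weights u; apply: H; exists jl. Qed.

Lemma local_variation_le jl u : D jl ->
  (local_variation b f u (alpha u (J jl)) jl <= (gamma u (J jl))%:E)%E.
Proof.
move=> Djl; apply: sqre_le1; first exact: gamma_gt0.
have sq0 (x : \bar R) : (0 <= x ^+ 2)%E by exact: sqre_ge0.
have T0 jl' : (0 <= \sum_(u : {set 'I_s}) ((gamma u (elem_box b jl'))^-1%:E *
      local_variation b f u (alpha u (elem_box b jl')) jl') ^+ 2)%E.
  by apply: sume_ge0 => v _; exact: sq0.
have := poweR_half_le (esum_ge0 (fun jl' _ => T0 jl')) f_ball.
rewrite expr1n; apply: le_trans.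
apply: esum_ge; exists [set jl]; first by split; [exact: finite_set1|move=> _ ->].
rewrite fsbig_set1 (bigD1 u)//=; apply: leeDl.
by apply: sume_ge0 => v _; exact: sq0.
Qed.

Let mu := [the {measure set (s.-tuple (measurableTypeR R)) -> \bar R} of @lebesgue_tuple R s].
Let G (y : s.-tuple (measurableTypeR R)) := f (rV_of_tuple y).

Let mG : measurable_fun setT G. Proof. exact: measurable_continuous_tuple. Qed.

Let mJ jl : measurable (tuple_set (J jl)). Proof. exact: measurable_tuple_box. Qed.

Let muJ jl : mu (tuple_set (J jl)) = (elem_volume R b jl)%:E.
Proof.
rewrite /J (elem_box_grid R jl 0 (prime_gt1 b_prime)) /mu /= lebesgue_tuple_box => [|i].
  rewrite grid_box_volume; congr EFin; apply: eq_bigr => i _.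
  by rewrite expn0 expr0 subr0 mulr1 divr1.
rewrite !mxE ler_pM2l ?exprz_gt0 ?ltr0n ?prime_gt0// lerD2l.
by rewrite expr0 !divr1 ler_nat.
Qed.

(* 2 |f| <= w + f^2 / w with w the quotient of gamma by the square root of the volume. *)
Lemma integral_abs_le jl : D jl ->
  (\int[mu]_(y in tuple_set (J jl)) `|(G y)%:E| <=
   (b%:R `^ ((\sum_i jl.1 0 i)%:~R / 2) * gamma finset.set0 (J jl))%:E)%E.
Proof.
move=> Djl; set g := gamma finset.set0 (J jl); set Vol := elem_volume R b jl.
have g0 : 0 < g by exact: gamma_gt0.
have b0 : 0 < b%:R :> R by rewrite ltr0n prime_gt0.
set q := b%:R `^ (_ / 2).
have q0 : 0 < q by rewrite powR_gt0.
have q2 : q ^+ 2 = Vol.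
  by rewrite powR_sqr_half powR_intmul ?ltW// -prodr_exprz ?gt_eqF.
have I2 : (\int[mu]_(y in tuple_set (J jl)) (G y ^+ 2)%:E <= (g ^+ 2)%:E)%E.
  have := local_variation_le finset.set0 Djl; rewrite /local_variation eqxx.
  have E : integral_rV (elem_box b jl) (fun x : 'rV[R]_s => `|f x| ^+ 2) =
      (\int[mu]_(y in tuple_set (J jl)) (G y ^+ 2)%:E)%E.
    by apply: eq_integral => y _; rewrite real_normK ?num_real.
  rewrite E; apply: poweR_half_le; apply: integral_ge0 => y _.
  by rewrite lee_fin sqr_ge0.
have mG2 : measurable_fun setT (fun y => (G y ^+ 2)%:E).
  by apply/measurable_EFinP; apply: measurable_funX.
have c0 : 0 <= q / g / 2 by rewrite !divr_ge0// ltW.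
have c1 : 0 <= g / q / 2 by rewrite !divr_ge0// ltW.
apply: (@le_trans _ _ (\int[mu]_(y in tuple_set (J jl))
   ((cst (g / q / 2)%:E) y + (q / g / 2)%:E * (G y ^+ 2)%:E))%E).
  apply: ge0_le_integral => //.
  - apply: measurableT_comp => //; apply/measurable_EFinP; exact: measurable_funS mG.
  - apply: measurable_funTS; apply: emeasurable_funD => //.
    by apply: emeasurable_funM.
  - move=> y _; rewrite /cst -EFinM -EFinD lee_fin.
    have -> : g / q / 2 + q / g / 2 * G y ^+ 2 = `|G y| + (`|G y| * q - g) ^+ 2 / (q * g * 2).
      by rewrite -(real_normK (num_real (G y))); field; rewrite !gt_eqF.
    by rewrite lerDl divr_ge0 ?sqr_ge0// !mulr_ge0// ltW.
rewrite ge0_integralD//; last 2 first.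
- by move=> y _; rewrite mule_ge0// lee_fin// sqr_ge0.
- by apply: measurable_funTS; apply: emeasurable_funM.
rewrite integral_cst ?muJ ?ge0_integralZl_EFin//; last 2 first.
- by move=> y _; rewrite lee_fin sqr_ge0.
- exact: measurable_funTS.
have := lee_wpmul2l _ I2; move=> /(_ (q / g / 2)%:E); rewrite lee_fin => /(_ c0) I3.
apply: (le_trans (leeD (lexx _) I3)); rewrite -!EFinM -EFinD lee_fin -/Vol -q2.
rewrite le_eqVlt; apply/orP; left; apply/eqP; field.
by rewrite !gt_eqF.
Qed.

End function_in_ball.

(** The codes given by [pickle] arrange the sets in a sequence, with the empty set at codes of no
    element of [D], so that sequential additivity applies. *)
Lemma ge0_integral_countable_bigcup d (T : measurableType d) (R : realType)
    (mu : {measure set T -> \bar R}) (I : countType) (D : set I) (F : I -> set T)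
    (g : T -> \bar R) :
  (forall i, measurable (F i)) -> measurable_fun setT g -> (forall y, 0 <= g y)%E ->
  trivIset D F ->
  (\int[mu]_(y in \bigcup_(i in D) F i) g y = \esum_(i in D) \int[mu]_(y in F i) g y)%E.
Proof.
move=> mF mg g0 tF.
pose E n := if pickle_inv n is Some i then if i \in D then F i else set0 else set0.
have EP i : D i -> E (pickle i) = F i.
  by move=> Di; rewrite /E pickleK_inv mem_set.
have Eex n : E n !=set0 -> exists2 i, D i & n = pickle i.
  rewrite /E; have := @pickle_invK I n; case: pickle_inv => [i /= <-|_ []//].
  by case: ifP => [/set_mem Di _|_ []//]; exists i.
have EU : \bigcup_(i in D) F i = \bigcup_n E n.
  apply/seteqP; split => y [i Di Fy]; first by exists (pickle i) => //; rewrite EP.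
  have [|l Dl il] := Eex i; first by exists y.
  by exists l => //; move: Fy; rewrite il EP.
have mE n : measurable (E n).
  by rewrite /E; case: pickle_inv => // i; case: ifP.
have tE : trivIset setT E.
  move=> n n' _ _ [y [En En']].
  have [|i Di ni] := Eex n; first by exists y.
  have [|i' Di' ni'] := Eex n'; first by exists y.
  rewrite ni ni'; congr pickle; apply: tF => //; exists y.
  by rewrite -EP// -ni -(EP i')// -ni'.
rewrite EU ge0_integral_bigcup//; last by apply: measurable_funTS.
rewrite nneseries_esumT => [|n]; last by apply: integral_ge0 => y _.
rewrite (esumID [set pickle i | i in D]) => [|n _]; last by apply: integral_ge0 => y _.
rewrite setTI [X in (_ + X)%E]esum1 ?adde0 => [|n [_ nD]]; last first.
  rewrite (_ : E n = set0) ?integral_set0//; apply/eqP/negPn/negP => /set0P/Eex[i Di ni].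
  by apply: nD; exists i.
rewrite esum_image; last by move=> i i' _ _; exact: (pcan_inj pickleK).
by apply: eq_esum => i Di; rewrite EP.
Qed.

Section worst_case.
Context (R : realType) (b s N : nat) (D : set ('rV[int]_s * 'rV[int]_s)).
Context (alpha gamma : {set 'I_s} -> set 'rV[R]_s -> R) (x : 'I_N -> 'rV[R]_s).
Context (lambda : 'I_N -> R) (t m : 'rV[int]_s * 'rV[int]_s -> nat).
Hypothesis b_prime : prime b.
Hypothesis s_gt0 : (0 < s)%N.
Hypothesis D_partition : partition D (@elem_box R b s) setT.
Hypothesis alpha_smooth : local_smoothness b D alpha.
Hypothesis gamma_weights : local_weights b D gamma.
Hypothesis nets : forall jl, D jl -> (0 < #|indices_in b x jl|)%N ->
  digital_net_in b (t jl) (m jl) jl x (indices_in b x jl).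
Hypothesis lambdaE : forall jl n, D jl -> n \in indices_in b x jl ->
  lambda n = b%:R ^ (\sum_i jl.1 0 i) / #|indices_in b x jl|%:R.

Let J jl : set 'rV[R]_s := elem_box b jl.

Let term u jl : R := gamma u (J jl) * net_constant b (alpha u (J jl)) u jl
  * b%:R `^ (- (alpha u (J jl) * (m jl - t jl)%:R))
  * 'C(m jl - t jl + #|u|, #|u|.-1)%:R.

Let gamma_gt0 u jl : D jl -> 0 < gamma u (J jl).
Proof. by move=> Djl; have [H _] := gamma_weights u; apply: H; exists jl. Qed.

Let term_ge0 u jl : D jl -> 0 <= term u jl.
Proof.
by move=> Djl; rewrite !mulr_ge0 ?powR_ge0// ltW// gamma_gt0.
Qed.

Let alpha_bounds u jl : u != finset.set0 -> D jl -> 2^-1 < alpha u (J jl) <= 1.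
Proof.
move=> u0 Djl; have [_ sup inf] := alpha_smooth u0.
have JD : elem_boxes b D (J jl) by exists jl.
rewrite -!lte_fin -lee_fin; apply/andP; split.
  by apply: (lt_le_trans inf); apply: ereal_inf_lbound; exists (J jl).
by apply: le_trans sup; apply: ereal_sup_ubound; exists (J jl).
Qed.

Lemma box_of_point n : exists jl, D jl /\ n \in indices_in b x jl.
Proof.
have [cov _ _] := D_partition.
have : [set: 'rV[R]_s] (x n) by [].
rewrite -cov => -[jl Djl Jx]; exists jl; split => //.
by rewrite inE; apply/mem_set.
Qed.

(** Each point lies in exactly one box of the partition, so the occupied boxes form a finite list
    along which the quadrature sum splits. *)
Lemma occupied_boxes : exists sp : seq ('rV[int]_s * 'rV[int]_s),
  [/\ uniq sp, forall jl, jl \in sp <-> D jl /\ (0 < #|indices_in b x jl|)%N &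
   forall g : 'I_N -> R, \sum_n g n = \sum_(jl <- sp) \sum_(n in indices_in b x jl) g n].
Proof.
have [_ tD _] := D_partition.
have [jn jnP] := choice box_of_point.
have jnE n jl : D jl -> n \in indices_in b x jl -> jl = jn n.
  move=> Djl; rewrite inE => /set_mem Jx; have [Dn] := jnP n; rewrite inE => /set_mem Jnx.
  by apply: tD => //; exists (x n).
exists (undup [seq jn n | n <- enum 'I_N]); split.
- exact: undup_uniq.
- move=> jl; rewrite mem_undup; split => [/mapP[n _ ->]|[Djl]].
    by have [Dn nJ] := jnP n; split => //; apply/card_gt0P; exists n.
  by move=> /card_gt0P[n nJ]; apply/mapP; exists n; [rewrite mem_enum|exact: jnE].
- move=> g; rewrite (exchange_big_dep xpredT)//=; apply: eq_bigr => n _.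
  have [Dn nJ] := jnP n.
  rewrite big_seq_cond (eq_bigl (fun jl => (jl \in undup [seq jn n | n <- enum 'I_N]) && (jl == jn n))).
    rewrite -big_seq_cond -big_filter (filter_pred1_uniq (undup_uniq _)) ?big_seq1//.
    by rewrite mem_undup; apply/mapP; exists n; rewrite ?mem_enum.
  move=> jl; apply: andb_id2l; rewrite mem_undup => /mapP[n' _ jlE].
  apply/idP/eqP => [|-> //]; apply: jnE.
  by rewrite jlE; have [] := jnP n'.
Qed.

Lemma error_le (f : 'rV[R]_s -> R) : continuous f ->
  (weighted_variation b D alpha gamma f <= 1)%E ->
  (`| (quadrature x lambda f)%:E - integral_rV setT f | <=
   \esum_(jl in [set jl | D jl /\ #|indices_in b x jl| = 0%N])
        (b%:R `^ ((\sum_i jl.1 0 i)%:~R / 2) * gamma finset.set0 (J jl))%:E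
   + \sum_(u : {set 'I_s} | u != finset.set0)
       \esum_(jl in [set jl | D jl /\ (0 < #|indices_in b x jl|)%N]) (term u jl)%:E)%E.
Proof.
move=> cf Vf; have [cov tD _] := D_partition.
have [sp [usp spP spS]] := occupied_boxes.
set D0 := [set jl | D jl /\ #|_| = _].
pose mu := [the {measure set (s.-tuple (measurableTypeR R)) -> \bar R} of @lebesgue_tuple R s].
pose G (y : s.-tuple (measurableTypeR R)) := f (rV_of_tuple y).
have mG : measurable_fun setT G by exact: measurable_continuous_tuple.
have mEG : measurable_fun setT (EFin \o G) by exact/measurable_EFinP.
pose Jt jl := tuple_set (J jl).
have mJt jl : measurable (Jt jl) by exact: measurable_tuple_box.
have tJt (E : set ('rV[int]_s * 'rV[int]_s)) : E `<=` D -> trivIset E Jt.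
  move=> ED jl jl' /ED Djl /ED Djl' [y [Jy Jy']]; apply: tD => //.
  by exists (rV_of_tuple y).
(* On [U1], a finite union, integrals are compared with net averages box by box; on [U0], a
   countable union, only the integral of |f| is estimated. *)
pose U1 := \big[setU/set0]_(jl <- sp) Jt jl; pose U0 := \bigcup_(jl in D0) Jt jl.
have U1E : U1 = \bigcup_(jl in [set` sp]) Jt jl by rewrite bigcup_seq.
have UT : U1 `|` U0 = setT.
  apply/seteqP; split => // y _.
  have : [set: 'rV[R]_s] (rV_of_tuple y) by [].
  rewrite -cov => -[jl Djl Jy].
  have [n0|n0] := posnP #|indices_in b x jl|; first by right; exists jl.
  by left; rewrite U1E; exists jl => //=; apply/spP.
have mU1 : measurable U1 by apply: bigsetU_measurable => jl _.
have mU0 : measurable U0.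
  rewrite /U0 bigcup_mkcond; apply: countable_bigcupT_measurable; first exact: countableP.
  by move=> jl; case: ifP.
have U10 : [disjoint U1 & U0].
  apply/disj_setPS => y [+ [jl' [Djl' n0] Jy']]; rewrite U1E => -[jl /= /spP[Djl n1] Jy].
  have E : jl = jl' by apply: tD => //; exists (rV_of_tuple y).
  by move: n1; rewrite E n0.
have IT : integral_rV setT f =
    (\int[mu]_(y in U1) (G y)%:E + \int[mu]_(y in U0) (G y)%:E)%E.
  rewrite -integral_setU//; last by rewrite UT.
  by rewrite UT.
have I0 : (`|\int[mu]_(y in U0) (G y)%:E| <= \esum_(jl in D0)
    (b%:R `^ ((\sum_i jl.1 0 i)%:~R / 2) * gamma finset.set0 (J jl))%:E)%E.
  apply: (le_trans (le_abse_integral _ mU0 _)); first exact: measurable_funS mEG.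
  rewrite ge0_integral_countable_bigcup//; last 2 first.
  - by apply: measurableT_comp.
  - by apply: tJt => jl [].
  apply: le_esum => jl [Djl _].
  exact: (integral_abs_le b_prime gamma_weights cf Vf Djl).
(* The oscillation bound 1 is arbitrary: only the finiteness of each integral is wanted. *)
have /choice[r rE] : forall jl, exists r, integral_rV (J jl) f = r%:E.
  move=> jl; have [K0 HK0] := oscillation_small jl (prime_gt1 b_prime) cf (@ltr01 R).
  have [r rE _] := riemann_sum b_prime cf (HK0 K0 (leqnn _)).
  by exists r.
have I1 : (\int[mu]_(y in U1) (G y)%:E = (\sum_(jl <- sp) r jl)%:E)%E.
  rewrite /U1 integral_bigsetU_EFin//.
  - by rewrite -sumEFin; apply: eq_bigr => jl _; rewrite -rE.
  - by apply: tJt => jl /spP[].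
  - exact: measurable_funS mEG.
have QE : quadrature x lambda f = \sum_(jl <- sp)
    (b%:R ^ (\sum_i jl.1 0 i) / #|indices_in b x jl|%:R *
     \sum_(n in indices_in b x jl) f (x n)).
  rewrite /quadrature spS [LHS]big_seq [RHS]big_seq; apply: eq_bigr => jl /spP[Djl _].
  by rewrite mulr_sumr; apply: eq_bigr => n nJ; rewrite (lambdaE Djl).
have Q1 : `|quadrature x lambda f - \sum_(jl <- sp) r jl| <=
    \sum_(jl <- sp) \sum_(u : {set 'I_s} | u != finset.set0) term u jl.
  rewrite QE -sumrB; apply: (le_trans (ler_norm_sum _ _ _)).
  rewrite [leLHS]big_seq [leRHS]big_seq; apply: ler_sum => jl /spP[Djl n1].
  apply: (net_error b_prime s_gt0 cf (nets Djl n1) _ (rE jl)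
    (alpha := alpha ^~ (J jl)) (gamma := gamma ^~ (J jl))) => u u0; split.
  - exact: alpha_bounds.
  - exact/ltW/gamma_gt0.
  - have := local_variation_le gamma_weights Vf u Djl.
    by rewrite /local_variation (negbTE u0).
have E1 : (\sum_(u : {set 'I_s} | u != finset.set0)
     \esum_(jl in [set jl | D jl /\ (0 < #|indices_in b x jl|)%N]) (term u jl)%:E)%E =
   (\sum_(jl <- sp) \sum_(u : {set 'I_s} | u != finset.set0) term u jl)%:E.
  rewrite exchange_big /= -sumEFin; apply: eq_bigr => u u0.
  rewrite (_ : mkset _ = [set` sp]); last first.
    by apply/seteqP; split => jl /spP.
  rewrite esum_fset => [||jl]; [|exact: finite_seq|by rewrite inE => /spP[Djl _]; rewrite lee_fin term_ge0].
  by rewrite -fsbig_seq// sumEFin.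
(* The integral over [U1] is a real number, which makes this regrouping legitimate in the extended
   reals. *)
rewrite E1 IT I1 oppeD// addeA -EFinB.
apply: (le_trans (lee_abs_sub _ _)).
by rewrite addeC leeD.
Qed.

End worst_case.

Theorem theorem14 (R : realType) (b s N : nat)
    (D : set ('rV[int]_s * 'rV[int]_s))
    (alpha gamma : {set 'I_s} -> set 'rV[R]_s -> R)
    (x : 'I_N -> 'rV[R]_s) (lambda : 'I_N -> R)
    (t m : 'rV[int]_s * 'rV[int]_s -> nat) :
  prime b -> (1 <= s)%N ->
  partition D (@elem_box R b s) setT ->
  local_smoothness b D alpha ->
  local_weights b D gamma ->
  summability b D alpha gamma ->
  (forall jl, D jl -> (0 < #|indices_in b x jl|)%N ->
     digital_net_in b (t jl) (m jl) jl x (indices_in b x jl)) ->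
  (forall jl n, D jl -> n \in indices_in b x jl ->
     lambda n = b%:R ^ (\sum_i jl.1 0 i) / #|indices_in b x jl|%:R) ->
  (worst_case_error b D alpha gamma x lambda <=
     \esum_(jl in [set jl | D jl /\ #|indices_in b x jl| = 0%N])
        (b%:R `^ ((\sum_i jl.1 0 i)%:~R / 2)
         * gamma finset.set0 (elem_box b jl))%:E
   + \sum_(u : {set 'I_s} | u != finset.set0)
       \esum_(jl in [set jl | D jl /\ (0 < #|indices_in b x jl|)%N])
         (gamma u (elem_box b jl)
          * net_constant b (alpha u (elem_box b jl)) u jl
          * b%:R `^ (- (alpha u (elem_box b jl) * (m jl - t jl)%:R))
          * 'C(m jl - t jl + #|u|, #|u|.-1)%:R)%:E)%E.
Proof.
move=> b_prime s_gt0 D_part smooth weights _ nets lambdaE.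
apply: ge_ereal_sup => _ [f [[cf _] Vf] <-].
exact: (error_le b_prime s_gt0 D_part smooth weights nets lambdaE cf Vf).
Qed.
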